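(* Let $K$ be a field, let $R$ be a finite-dimensional quasi-Frobenius $K$-algebra, and let $n\geq 2$ be an integer. Let $e_1,\ldots,e_q$ be idempotents of $R$ such that $Re_1,\ldots,Re_q$ is a system of representatives for the isomorphism types of principal indecomposable left $R$-modules, let $m_1,\ldots,m_q$ be their multiplicities in $R$, and let $\pi$ be the Nakayama permutation of $\{1,\ldots,q\}$. Then $A(R,n)$ is Frobenius if and only if $m_i=m_{\pi^{n-2}(i)}$ for any $1\leq i\leq q$.
   Context: All algebras, vector spaces and linear duals are over $K$; $R^*=\mathrm{Hom}_K(R,K)$ is an $R$-bimodule via $(r\rightharpoonup r^* )(s)=r^*(sr)$ and $(r^*\leftharpoonup r)(s)=r^*(rs)$. Convention: $M^{\otimes_R 0}=R$, $M^{\otimes_R 1}=M$. A finite-dimensional algebra $B$ is quasi-Frobenius if $B$ is an injective left $B$-module, and Frobenius if $B^*\simeq B$ as left $B$-modules. The multiplicities satisfy $R\simeq(Re_1)^{m_1}\oplus\cdots\oplus(Re_q)^{m_q}$ as left $R$-modules. For a left $R$-module $M$, $\mathrm{soc}(M)$ is its socle and $\mathrm{top}(M)=M/J(R)M$, where $J(R)$ is the Jacobson radical. The Nakayama permutation $\pi$ of the quasi-Frobenius algebra $R$ is the permutation of $\{1,\ldots,q\}$ such that $\mathrm{top}(Re_i)\simeq\mathrm{soc}(Re_{\pi(i)})$ for any $1\leq i\leq q$. $A(R,n)$ is the factor algebra of the tensor algebra $T_R(R^* )=\bigoplus_{i\geq 0}(R^* )^{\otimes_R i}$ by the two-sided ideal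 generated by all elements $r_1^*\otimes_R\cdots\otimes_R r_n^*$ with $r_1^*,\ldots,r_n^*\in R^*$; thus $A(R,n)=R\oplus R^*\oplus\cdots\oplus(R^* )^{\otimes_R(n-1)}$ with multiplication given by tensor concatenation when the total length is less than $n$, and zero otherwise. *)

(* Defs.v *)
From HB Require Import structures.
From mathcomp Require Import all_boot all_algebra all_fingroup all_field.
From mathcomp Require Import boolp.

Set Implicit Arguments.
Unset Strict Implicit.
Unset Printing Implicit Defensive.

Import GRing.Theory.
Local Open Scope ring_scope.
Local Open Scope quotient_scope.

Section GeneratedSubmodule.
Variables (R : nzRingType) (M : lmodType R) (P : M -> Prop).

(* The intersection of the submodules of M containing P. *)
Definition gen_submod : {pred M} := fun x =>
  `[< forall S : submodClosed M, (forall y, P y -> y \in S) -> x \in S >].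

Lemma gen_submodP x : reflect
  (forall S : submodClosed M, (forall y, P y -> y \in S) -> x \in S)
  (x \in gen_submod).
Proof. exact: asboolP. Qed.

Lemma gen_submod_closed : submod_closed gen_submod.
Proof.
split=> [|a x y /gen_submodP Sx /gen_submodP Sy]; apply/gen_submodP => S PS.
  exact: rpred0.
by rewrite rpredD ?rpredZ ?Sx ?Sy.
Qed.

HB.instance Definition _ :=
  GRing.isSubmodClosed.Build R M gen_submod gen_submod_closed.

Lemma mem_gen_submod x : P x -> x \in gen_submod.
Proof. by move=> Px; apply/gen_submodP => S; apply. Qed.

End GeneratedSubmodule.

Section SubQuotient.
Variables (R : nzRingType) (M : lmodType R) (S : submodClosed M).

Inductive submod : predArgType := Submod x & x \in S.
Definition submod_val (u : submod) : M := let: Submod x _ := u in x.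
HB.instance Definition _ := [isSub of submod for submod_val].
HB.instance Definition _ := [Choice of submod by <:].
HB.instance Definition _ :=
  GRing.SubChoice_isSubLmodule.Build R M _ submod (submodClosedP S).

(* Generic zmodType quotients require a zmodClosed predicate, which a         *)
(* submodClosed one is not declared to be.                                    *)
Definition quo_pred : {pred M} := fun x => x \in S.
HB.instance Definition _ :=
  GRing.isSubmodClosed.Build R M quo_pred (submodClosedP S).

Definition quomod : Type := (Quotient.quot quo_pred).
HB.instance Definition _ := Choice.on quomod.
HB.instance Definition _ := GRing.Zmodule.on quomod.

Definition quo_pi (x : M) : quomod := \pi_(Quotient.quot quo_pred) x.
Definition quo_repr (u : quomod) : M := generic_quotient.repr (u : (Quotient.quot quo_pred)).

Lemma quo_reprK : cancel quo_repr quo_pi.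
Proof. by move=> u; rewrite /quo_pi /quo_repr reprK. Qed.

Lemma quo_piP x y : quo_pi x = quo_pi y <-> x - y \in S.
Proof. by rewrite -[_ \in S]/(_ \in quo_pred) Quotient.idealrBE /quo_pi; split=> [->|/eqP]. Qed.

Fact quo_pi_is_zmod_morphism : zmod_morphism quo_pi.
Proof. by move=> x y; rewrite /quo_pi raddfB. Qed.
HB.instance Definition _ :=
  GRing.isZmodMorphism.Build M quomod quo_pi quo_pi_is_zmod_morphism.

Definition quo_scale (a : R) (u : quomod) : quomod :=
  quo_pi (a *: quo_repr u).

Lemma quo_scale_pi a x : quo_scale a (quo_pi x) = quo_pi (a *: x).
Proof.
by apply/quo_piP; rewrite -scalerBr rpredZ //; apply/quo_piP/quo_reprK.
Qed.

Fact quo_scaleA a b u : quo_scale a (quo_scale b u) = quo_scale (a * b) u.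
Proof. by rewrite -[u]quo_reprK !quo_scale_pi scalerA. Qed.
Fact quo_scale1 : left_id 1 quo_scale.
Proof. by move=> u; rewrite -[u]quo_reprK quo_scale_pi scale1r. Qed.
Fact quo_scaleDr : right_distributive quo_scale +%R.
Proof.
move=> a u v; rewrite -[u]quo_reprK -[v]quo_reprK -raddfD !quo_scale_pi.
by rewrite scalerDr raddfD.
Qed.
Fact quo_scaleDl u : {morph quo_scale^~ u : a b / a + b}.
Proof. by move=> a b; rewrite -[u]quo_reprK !quo_scale_pi scalerDl raddfD. Qed.

HB.instance Definition _ := GRing.Zmodule_isLmodule.Build R quomod
  quo_scaleA quo_scale1 quo_scaleDr quo_scaleDl.

Fact quo_pi_is_scalable : scalable quo_pi.
Proof. by move=> a x; rewrite -quo_scale_pi. Qed.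
HB.instance Definition _ :=
  GRing.isScalable.Build R M quomod *:%R quo_pi quo_pi_is_scalable.

End SubQuotient.

Section DirectSum.
Variables (R : nzRingType) (I : finType) (T : I -> lmodType R).

Definition dsum : Type := {dffun forall i, T i}.
HB.instance Definition _ := Choice.on dsum.
Implicit Types (u v : dsum) (a b : R).

Definition dcoord i u : T i := u i.
Definition dsum_of (f : forall i, T i) : dsum := [ffun i => f i].

Lemma dsum_ofE f i : dcoord i (dsum_of f) = f i. Proof. exact: ffunE. Qed.
Lemma dsumP u v : (forall i, dcoord i u = dcoord i v) <-> u = v.
Proof. exact: ffunP. Qed.

Definition dsum_add u v : dsum := dsum_of (fun i => dcoord i u + dcoord i v).
Definition dsum_opp u : dsum := dsum_of (fun i => - dcoord i u).
Definition dsum_zero : dsum := dsum_of (fun i => 0).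
Definition dsum_scale a u : dsum := dsum_of (fun i => a *: dcoord i u).

Fact dsum_addA : associative dsum_add.
Proof. by move=> u v w; apply/dsumP=> i; rewrite !dsum_ofE addrA. Qed.
Fact dsum_addC : commutative dsum_add.
Proof. by move=> u v; apply/dsumP=> i; rewrite !dsum_ofE addrC. Qed.
Fact dsum_add0 : left_id dsum_zero dsum_add.
Proof. by move=> u; apply/dsumP=> i; rewrite !dsum_ofE add0r. Qed.
Fact dsum_addN : left_inverse dsum_zero dsum_opp dsum_add.
Proof. by move=> u; apply/dsumP=> i; rewrite !dsum_ofE addNr. Qed.
HB.instance Definition _ := GRing.isZmodule.Build dsum
  dsum_addA dsum_addC dsum_add0 dsum_addN.

Fact dsum_scaleA a b u : dsum_scale a (dsum_scale b u) = dsum_scale (a * b) u.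
Proof. by apply/dsumP=> i; rewrite !dsum_ofE scalerA. Qed.
Fact dsum_scale1 : left_id 1 dsum_scale.
Proof. by move=> u; apply/dsumP=> i; rewrite !dsum_ofE scale1r. Qed.
Fact dsum_scaleDr : right_distributive dsum_scale +%R.
Proof. by move=> a u v; apply/dsumP=> i; rewrite !dsum_ofE scalerDr. Qed.
Fact dsum_scaleDl u : {morph dsum_scale^~ u : a b / a + b}.
Proof. by move=> a b; apply/dsumP=> i; rewrite !dsum_ofE scalerDl. Qed.
HB.instance Definition _ := GRing.Zmodule_isLmodule.Build R dsum
  dsum_scaleA dsum_scale1 dsum_scaleDr dsum_scaleDl.

Fact dcoord_is_linear i : linear (dcoord i).
Proof. by move=> a u v; rewrite /= !dsum_ofE. Qed.
HB.instance Definition _ i :=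
  GRing.isLinear.Build R dsum (T i) _ (dcoord i) (dcoord_is_linear i).

End DirectSum.

Definition lmod_iso (R : nzRingType) (M N : lmodType R) : Prop :=
  exists f : {linear M -> N}, bijective f.

Definition lmod_zero (R : nzRingType) (M : lmodType R) : Prop :=
  forall x : M, x = 0.

Definition simple_lmod (R : nzRingType) (M : lmodType R) : Prop :=
  ~ lmod_zero M /\
  forall S : submodClosed M, S =i pred1 0 \/ S =i predT.

Definition indecomposable_lmod (R : nzRingType) (M : lmodType R) : Prop :=
  ~ lmod_zero M /\
  forall N P : lmodType R, lmod_iso M (N * P)%type -> lmod_zero N \/ lmod_zero P.

Definition injective_lmod (R : nzRingType) (Q : lmodType R) : Prop :=
  forall (M N : lmodType R) (i : {linear M -> N}) (f : {linear M -> Q}),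
  injective i -> exists g : {linear N -> Q}, forall x, g (i x) = f x.

(* The sum of the simple submodules. *)
Definition soc (R : nzRingType) (M : lmodType R) : submodClosed M :=
  gen_submod (fun x => exists2 S : submodClosed M, simple_lmod (submod S) & x \in S).

Section Top.
Variables (R : nzRingType) (M : lmodType R).

Definition maximal_left_ideal (I : submodClosed R^o) : Prop :=
  ~ (I =i predT) /\
  forall S : submodClosed R^o, {subset I <= S} -> S =i I \/ S =i predT.

Definition in_jacobson (a : R) : Prop :=
  forall I : submodClosed R^o, maximal_left_ideal I -> a \in I.

(* The submodule J(R) M of M. *)
Definition rad : submodClosed M :=
  gen_submod (fun x => exists a m, in_jacobson a /\ x = a *: m).

Definition top : lmodType R := quomod rad.

End Top.

Definition principal_indecomposable (R : nzRingType) (P : lmodType R) : Prop :=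
  indecomposable_lmod P /\ exists Q : lmodType R, lmod_iso R^o (P * Q)%type.

Definition lideal (R : nzRingType) (e : R) : lmodType R :=
  submod (gen_submod (fun x : R^o => exists r : R, x = r * e)).

Section Bilinear.
Variables (K : fieldType) (U V W : lmodType K).

Definition bilin (f : U -> V -> W) : Prop :=
  (forall x, linear (f x)) /\ (forall y, linear (f^~ y)).

Definition mklin (f : U -> V) (lin_f : linear f) : {linear U -> V} :=
  HB.pack f (GRing.isLinear.Build K U V *:%R f lin_f).

End Bilinear.

Lemma lin_sum (K : fieldType) (U V : lmodType K) (f : U -> V)
  (I : Type) (r : seq I) (P : pred I) (F : I -> U) : linear f ->
  f (\sum_(i <- r | P i) F i) = \sum_(i <- r | P i) f (F i).
Proof. by move=> lf; apply: (raddf_sum (mklin lf)). Qed.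

Lemma linD (K : fieldType) (U V : lmodType K) (f : U -> V) : linear f ->
  {morph f : x y / x + y}.
Proof. by move=> lf; apply: (raddfD (mklin lf)). Qed.

Lemma linB (K : fieldType) (U V : lmodType K) (f : U -> V) : linear f ->
  {morph f : x y / x - y}.
Proof. by move=> lf; apply: (raddfB (mklin lf)). Qed.

Lemma lin0 (K : fieldType) (U V : lmodType K) (f : U -> V) : linear f ->
  f 0 = 0.
Proof. by move=> lf; apply: (raddf0 (mklin lf)). Qed.

Lemma linZ (K : fieldType) (U V : lmodType K) (f : U -> V) : linear f ->
  scalable f.
Proof. by move=> lf; apply: (linearZ_LR (mklin lf)). Qed.

Lemma lin_comp (K : fieldType) (U V W : lmodType K) (f : V -> W) (g : U -> V) :
  linear f -> linear g -> linear (f \o g).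
Proof. by move=> lf lg k x y; rewrite /= lg lf. Qed.

Section QuotientVector.
Variables (K : fieldType) (V : vectType K) (S : submodClosed V).

Lemma submod_vspace : exists U : {vspace V}, S =i U.
Proof.
pose P n := `[< exists2 U : {vspace V}, {subset U <= S} & \dim U = n >].
have exP : exists n, P n.
  exists 0%N; apply/asboolP; exists 0%VS; rewrite ?dimv0 // => x.
  by rewrite memv0 => /eqP->; apply: rpred0.
have leP n : P n -> (n <= \dim {:V})%N.
  by move=> /asboolP[U _ <-]; apply/dimvS/subvf.
case: (ex_maxnP exP leP) => n /asboolP[U US dimU] maxn; exists U => x.
apply/idP/idP => [xS|/US//]; apply: contraT => xU.
suff: (\dim (U + <[x]>) <= n)%N.
  rewrite -dimU => dimUx; case/negP: xU.
  have /eqP-> : U == (U + <[x]>)%VS by rewrite eqEdim addvSl.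
  exact/(subvP (addvSr _ _))/memv_line.
apply/maxn/asboolP; exists (U + <[x]>)%VS => // y.
by case/memv_addP=> u uU [_ /vlineP[k ->] ->]; apply: rpredD; [exact: US | exact: rpredZ].
Qed.

Fact quomod_vect_iso : {n : nat & Vector.axiom n (quomod S)}.
Proof.
have [U SU] := cid submod_vspace.
have dUW : (U^C :&: U)%VS = 0%VS by rewrite capvC capv_compl.
have dWU : (U :&: U^C)%VS = 0%VS by rewrite capv_compl.
exists (\dim U^C)%VS.
have [c lin_c bij_c] := subvs_vect_iso (U^C)%VS.
pose p : 'End(V) := daddv_pi U^C U.
have pU x : x \in U -> p x = 0.
  move=> xU; have /(daddv_pi_add dUW) : x \in (U^C + U)%VS.
    by apply: (subvP (addvSr _ _)).
  by rewrite (daddv_pi_id dWU xU) -[RHS]add0r => /addIr.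
pose g (u : quomod S) : subvs_of U^C := vsproj U^C (p (quo_repr u)).
have gE x : g (quo_pi S x) = vsproj U^C (p x).
  congr vsproj; apply/eqP; rewrite -subr_eq0 -raddfB; apply/eqP/pU.
  by rewrite -SU; apply/quo_piP/quo_reprK.
exists (c \o g).
  move=> k u v; rewrite -[u]quo_reprK -[v]quo_reprK -linearP /= !gE.
  by rewrite linearP linearP lin_c.
apply: bij_comp bij_c _; exists (fun w => quo_pi S (vsval w)) => [u|w].
  rewrite -[RHS]quo_reprK /g vsprojK ?memv_pi //.
  apply/esym/quo_piP; rewrite SU.
  set x := quo_repr u; have xE : p x + daddv_pi U U^C x = x.
    by apply: (daddv_pi_add dUW); rewrite addvC addv_complf memvf.
  by rewrite -[X in X - _]xE addrAC subrr add0r memv_pi.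
rewrite gE (daddv_pi_id dUW) ?subvsP //; exact: vsvalK.
Qed.

HB.instance Definition _ :=
  Lmodule_hasFinDim.Build K (quomod S) (projT2 quomod_vect_iso).

End QuotientVector.

(* Both K-actions of a bimodule are the K-vector space structure: this is the *)
(* content of bilinearity over K of lact and ract.                            *)
Record bimodule (K : fieldType) (R : falgType K) : Type := Bimodule {
  bim_sort :> vectType K;
  lact : R -> bim_sort -> bim_sort;
  ract : bim_sort -> R -> bim_sort;
  lact_bilin : bilin lact;
  ract_bilin : bilin ract;
  lact1 : forall x, lact 1 x = x;
  ract1 : forall x, ract x 1 = x;
  lactA : forall r s x, lact r (lact s x) = lact (r * s) x;
  ractA : forall x r s, ract (ract x r) s = ract x (r * s);
  lractA : forall r x s, ract (lact r x) s = lact r (ract x s)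
}.

Section RegularBimodule.
Variables (K : fieldType) (R : falgType K).

Fact regular_bilin : bilin ( *%R : R -> R -> R).
Proof.
split=> x k y z /=; first by rewrite mulrDr scalerAr.
by rewrite mulrDl scalerAl.
Qed.

Definition regular_bimodule : bimodule R :=
  @Bimodule K R R *%R *%R regular_bilin regular_bilin (@mul1r R) (@mulr1 R)
    (@mulrA R) (fun x y z => esym (mulrA x y z))
    (fun x y z => esym (mulrA x y z)).

End RegularBimodule.

Section DualBimodule.
Variables (K : fieldType) (R : falgType K).
Notation dual := 'Hom(R, K^o).
Implicit Types (f g : dual) (r s : R).

Definition dual_lact r f : dual := linfun (fun s => f (s * r)).
Definition dual_ract f r : dual := linfun (fun s => f (r * s)).

Lemma dual_lactE r f s : dual_lact r f s = f (s * r).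
Proof.
have lin_fr : linear (fun s => f (s * r) : K^o).
  by move=> k x y; rewrite mulrDl -scalerAl linearP.
exact: (lfunE (mklin lin_fr)).
Qed.

Lemma dual_ractE f r s : dual_ract f r s = f (r * s).
Proof.
have lin_fr : linear (fun s => f (r * s) : K^o).
  by move=> k x y; rewrite mulrDr -scalerAr linearP.
exact: (lfunE (mklin lin_fr)).
Qed.

Fact dual_lact_bilin : bilin dual_lact.
Proof.
split=> [r k f g|f k r s]; apply/lfunP=> x.
  by rewrite !(add_lfunE, scale_lfunE, dual_lactE).
by rewrite !(add_lfunE, scale_lfunE, dual_lactE) mulrDr -scalerAr linearP.
Qed.

Fact dual_ract_bilin : bilin dual_ract.
Proof.
split=> [f k r s|r k f g]; apply/lfunP=> x.
  by rewrite !(add_lfunE, scale_lfunE, dual_ractE) mulrDl -scalerAl linearP.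
by rewrite !(add_lfunE, scale_lfunE, dual_ractE).
Qed.

Fact dual_lact1 f : dual_lact 1 f = f.
Proof. by apply/lfunP=> x; rewrite dual_lactE mulr1. Qed.
Fact dual_ract1 f : dual_ract f 1 = f.
Proof. by apply/lfunP=> x; rewrite dual_ractE mul1r. Qed.
Fact dual_lactA r s f : dual_lact r (dual_lact s f) = dual_lact (r * s) f.
Proof. by apply/lfunP=> x; rewrite !dual_lactE mulrA. Qed.
Fact dual_ractA f r s : dual_ract (dual_ract f r) s = dual_ract f (r * s).
Proof. by apply/lfunP=> x; rewrite !dual_ractE mulrA. Qed.
Fact dual_lractA r f s : dual_ract (dual_lact r f) s = dual_lact r (dual_ract f s).
Proof. by apply/lfunP=> x; rewrite !(dual_lactE, dual_ractE) mulrA. Qed.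

(* R^*, with (r f)(s) = f (s r) and (f r)(s) = f (r s). *)
Definition dual_bimodule : bimodule R :=
  Bimodule dual_lact_bilin dual_ract_bilin dual_lact1 dual_ract1
    dual_lactA dual_ractA dual_lractA.

End DualBimodule.

Section Tensor.
Import VectorInternalTheory.
Variables (K : fieldType) (R : falgType K) (M N : bimodule R).

(* M (x)_K N is realized as a matrix space, through coordinates. *)
Definition otimesK (x : M) (y : N) : 'M[K]_(dim M, dim N) :=
  (v2r x)^T *m v2r y.

(* M (x)_R N is the quotient of M (x)_K N by the K-subspace spanned by the    *)
(* (x r) (x) y - x (x) (r y).                                                 *)
Definition balancing : submodClosed 'M[K]_(dim M, dim N) :=
  gen_submod (fun A => exists x r y,
    A = otimesK (ract x r) y - otimesK x (lact r y)).

Definition tensor : vectType K := quomod balancing.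
Definition otimes (x : M) (y : N) : tensor := quo_pi balancing (otimesK x y).

Lemma otimes_bilin : bilin otimes.
Proof.
split=> x k y z; rewrite /otimes -linearP; congr quo_pi.
  by rewrite /otimesK linearP mulmxDr -scalemxAr.
by rewrite /otimesK !linearP mulmxDl -scalemxAl.
Qed.

Lemma otimes_balanced x r y : otimes (ract x r) y = otimes x (lact r y).
Proof. by apply/quo_piP/mem_gen_submod; exists x, r, y. Qed.

Let bM i : M := r2v (delta_mx 0 i).
Let bN j : N := r2v (delta_mx 0 j).

Let bME x : x = \sum_i v2r x 0 i *: bM i.
Proof.
rewrite -[LHS]v2rK {1}[v2r x]row_sum_delta linear_sum.
by apply: eq_bigr => i _; rewrite linearZ.
Qed.
Let bNE y : y = \sum_j v2r y 0 j *: bN j.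
Proof.
rewrite -[LHS]v2rK {1}[v2r y]row_sum_delta linear_sum.
by apply: eq_bigr => i _; rewrite linearZ.
Qed.

Lemma tensor_sum (t : tensor) :
  t = \sum_i \sum_j quo_repr t i j *: otimes (bM i) (bN j).
Proof.
rewrite -[LHS]quo_reprK {1}[quo_repr t]matrix_sum_delta linear_sum.
apply: eq_bigr => i _; rewrite linear_sum; apply: eq_bigr => j _.
rewrite linearZ; congr (_ *: quo_pi _ _).
by rewrite /otimesK !r2vK trmx_delta mul_delta_mx.
Qed.

Lemma tensor_ext (P : lmodType K) (g h : tensor -> P) : linear g -> linear h ->
  (forall x y, g (otimes x y) = h (otimes x y)) -> g =1 h.
Proof.
move=> lg lh gh t; rewrite [t]tensor_sum !lin_sum //.
apply: eq_bigr => i _; rewrite !lin_sum //; apply: eq_bigr => j _.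
by rewrite !linZ // gh.
Qed.

(* The linear map M (x)_R N -> P induced by a balanced bilinear f. *)
Definition tensor_lift (P : lmodType K) (f : M -> N -> P) (t : tensor) : P :=
  \sum_i \sum_j quo_repr t i j *: f (bM i) (bN j).

Section Lift.
Variables (P : lmodType K) (f : M -> N -> P).
Hypotheses (bilin_f : bilin f).
Hypothesis bal_f : forall x r y, f (ract x r) y = f x (lact r y).

Let lift0 (A : 'M_(dim M, dim N)) : P :=
  \sum_i \sum_j A i j *: f (bM i) (bN j).

Let lift0_linear : linear lift0.
Proof.
move=> k A B; rewrite /lift0 scaler_sumr -big_split /=; apply: eq_bigr => i _.
rewrite scaler_sumr -big_split /=; apply: eq_bigr => j _.
by rewrite !mxE scalerDl scalerA.
Qed.

Let lift0E x y : lift0 (otimesK x y) = f x y.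
Proof.
rewrite [in RHS](bME x) (lin_sum _ _ _ (bilin_f.2 y)); apply: eq_bigr => i _.
rewrite (linZ (bilin_f.2 y)) [in RHS](bNE y) (lin_sum _ _ _ (bilin_f.1 _)).
rewrite scaler_sumr; apply: eq_bigr => j _.
rewrite (linZ (bilin_f.1 _)) scalerA; congr (_ *: _).
by rewrite !mxE big_ord1 !mxE.
Qed.

Let lift0_bal A : A \in balancing -> lift0 A = 0.
Proof.
pose ker : {pred 'M[K]_(dim M, dim N)} := fun A => lift0 A == 0.
have ker_closed : submod_closed ker.
  split=> [|k B C]; rewrite !unfold_in ?lin0 // => /eqP B0 /eqP C0.
  by rewrite lift0_linear B0 C0 scaler0 addr0.
pose kerS : submodClosed _ :=
  HB.pack ker (GRing.isSubmodClosed.Build K _ ker ker_closed).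
move=> /gen_submodP/(_ kerS) kerA; apply/eqP/kerA => _ [x [r [y ->]]].
by rewrite unfold_in /= /ker linB // !lift0E bal_f subrr.
Qed.

Let lift_pi A : tensor_lift f (quo_pi balancing A) = lift0 A.
Proof.
apply/eqP; rewrite -subr_eq0 -[tensor_lift _ _]/(lift0 _) -linB //.
by apply/eqP/lift0_bal/quo_piP/quo_reprK.
Qed.

Lemma tensor_lift_linear : linear (tensor_lift f).
Proof.
move=> k u v; rewrite -[u]quo_reprK -[v]quo_reprK -linearP !lift_pi.
exact: lift0_linear.
Qed.

Lemma tensor_liftE x y : tensor_lift f (otimes x y) = f x y.
Proof. by rewrite lift_pi lift0E. Qed.

End Lift.

Definition tensor_lact (r : R) : tensor -> tensor :=
  tensor_lift (fun x y => otimes (lact r x) y).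
Definition tensor_ract (t : tensor) (r : R) : tensor :=
  tensor_lift (fun x y => otimes x (ract y r)) t.

Let lact_f r := fun x y => otimes (lact r x) y.
Let ract_f r := fun x y => otimes x (ract y r).

Let lact_f_bilin r : bilin (lact_f r).
Proof.
split=> x k y z; rewrite /lact_f; first exact: otimes_bilin.1.
by rewrite (lact_bilin _).1 otimes_bilin.2.
Qed.
Let ract_f_bilin r : bilin (ract_f r).
Proof.
split=> x k y z; rewrite /ract_f; last exact: otimes_bilin.2.
by rewrite (ract_bilin _).2 otimes_bilin.1.
Qed.
Let lact_f_bal r x s y : lact_f r (ract x s) y = lact_f r x (lact s y).
Proof. by rewrite /lact_f -lractA otimes_balanced. Qed.
Let ract_f_bal r x s y : ract_f r (ract x s) y = ract_f r x (lact s y).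
Proof. by rewrite /ract_f lractA otimes_balanced. Qed.

Lemma tensor_lactE r x y : tensor_lact r (otimes x y) = otimes (lact r x) y.
Proof. exact: (tensor_liftE (lact_f_bilin r) (lact_f_bal r)). Qed.
Lemma tensor_ractE r x y : tensor_ract (otimes x y) r = otimes x (ract y r).
Proof. exact: (tensor_liftE (ract_f_bilin r) (ract_f_bal r)). Qed.

Lemma tensor_lact_linear r : linear (tensor_lact r).
Proof. exact: (tensor_lift_linear (lact_f_bilin r) (lact_f_bal r)). Qed.
Lemma tensor_ract_linear r : linear (tensor_ract^~ r).
Proof. exact: (tensor_lift_linear (ract_f_bilin r) (ract_f_bal r)). Qed.

Fact tensor_lact_bilin : bilin tensor_lact.
Proof.
split=> [|t k r s]; first exact: tensor_lact_linear.
pose h t := k *: tensor_lact r t + tensor_lact s t.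
apply: (@tensor_ext _ (tensor_lact (k *: r + s)) h) => [||x y].
- exact: tensor_lact_linear.
- move=> l u v; rewrite /h !tensor_lact_linear !scalerDr !scalerA mulrC.
  by rewrite addrACA.
- by rewrite /h !tensor_lactE (lact_bilin _).2 otimes_bilin.2.
Qed.

Fact tensor_ract_bilin : bilin tensor_ract.
Proof.
split=> [t k r s|]; last exact: tensor_ract_linear.
pose h t := k *: tensor_ract t r + tensor_ract t s.
apply: (@tensor_ext _ (tensor_ract^~ (k *: r + s)) h) => [||x y].
- exact: tensor_ract_linear.
- move=> l u v; rewrite /h !tensor_ract_linear !scalerDr !scalerA mulrC.
  by rewrite addrACA.
- by rewrite /h !tensor_ractE (ract_bilin _).1 otimes_bilin.1.
Qed.

Let idlin : linear (fun t : tensor => t). Proof. by []. Qed.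
Fact tensor_lact1 t : tensor_lact 1 t = t.
Proof.
apply: (tensor_ext (tensor_lact_linear 1) idlin) => x y.
by rewrite tensor_lactE lact1.
Qed.
Fact tensor_ract1 t : tensor_ract t 1 = t.
Proof.
apply: (tensor_ext (tensor_ract_linear 1) idlin) => x y.
by rewrite tensor_ractE ract1.
Qed.
Fact tensor_lactA r s t :
  tensor_lact r (tensor_lact s t) = tensor_lact (r * s) t.
Proof.
apply: (tensor_ext (lin_comp (tensor_lact_linear r) (tensor_lact_linear s))
  (tensor_lact_linear _)) => x y.
by rewrite /= !tensor_lactE lactA.
Qed.
Fact tensor_ractA t r s :
  tensor_ract (tensor_ract t r) s = tensor_ract t (r * s).
Proof.
apply: (tensor_ext (lin_comp (tensor_ract_linear s) (tensor_ract_linear r))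
  (tensor_ract_linear _)) => x y.
by rewrite /= !tensor_ractE ractA.
Qed.
Fact tensor_lractA r t s :
  tensor_ract (tensor_lact r t) s = tensor_lact r (tensor_ract t s).
Proof.
apply: (tensor_ext (lin_comp (tensor_ract_linear s) (tensor_lact_linear r))
  (lin_comp (tensor_lact_linear r) (tensor_ract_linear s))) => x y.
by rewrite /= !(tensor_ractE, tensor_lactE).
Qed.

Definition tensor_bimodule : bimodule R :=
  Bimodule tensor_lact_bilin tensor_ract_bilin tensor_lact1 tensor_ract1
    tensor_lactA tensor_ractA tensor_lractA.

End Tensor.

Section TensorPower.
Variables (K : fieldType) (R : falgType K) (M : bimodule R).

(* The tensor powers over R, the 0-th one being R and the first one M. *)
Fixpoint tpow (i : nat) : bimodule R :=
  match i with
  | 0 => regular_bimodule R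
  | 1 => M
  | j.+1 => tensor_bimodule M (tpow j)
  end.

(* Concatenation x (x) y for x of length 1. *)
Definition tcons (j : nat) : M -> tpow j -> tpow j.+1 :=
  match j return M -> tpow j -> tpow j.+1 with
  | 0 => fun x r => ract x r
  | j'.+1 => fun x y => otimes x (y : tpow j'.+1)
  end.

(* Concatenation, through (x (x) t) y = x (x) (t y) for x in M. *)
Fixpoint tcat (i j : nat) : tpow i -> tpow j -> tpow (i + j)%N :=
  match i return tpow i -> tpow j -> tpow (i + j)%N with
  | 0 => fun r y => lact r y
  | i'.+1 =>
    match i' return (tpow i' -> tpow j -> tpow (i' + j)%N) ->
      tpow i'.+1 -> tpow j -> tpow (i' + j).+1%N with
    | 0 => fun _ x y => tcons x y
    | _ => fun tcat' x y =>
        tensor_lift (fun z t => tcons z (tcat' t y)) x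
    end (@tcat i' j)
  end.

Lemma tcons_bilin j : bilin (@tcons j).
Proof. by case: j => [|j]; [exact: ract_bilin | exact: otimes_bilin]. Qed.

Lemma tcons_balanced j x r (y : tpow j) :
  tcons (ract x r) y = tcons x (lact r y).
Proof. by case: j y => [|j] y /=; [rewrite ractA | rewrite otimes_balanced]. Qed.

Lemma lact_tcons j r x (y : tpow j) : lact r (tcons x y) = tcons (lact r x) y.
Proof. by case: j y => [|j] y /=; [rewrite lractA | rewrite tensor_lactE]. Qed.

Lemma tcons_ext (P : lmodType K) j (g h : tpow j.+1 -> P) : linear g ->
  linear h -> (forall x t, g (tcons x t) = h (tcons x t)) -> g =1 h.
Proof.
case: j g h => [|j] g h lg lh gh; last exact: tensor_ext lg lh gh.
by move=> x; have /= := gh x 1; rewrite ract1.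
Qed.

Let tcat_step i j y (f := fun z t => tcons z (@tcat i j t y)) :
  bilin (@tcat i j) ->
  (forall r (t : tpow i), tcat (lact r t) y = lact r (tcat t y)) ->
  bilin f /\ forall x r t, f (ract x r) t = f x (lact r t).
Proof.
move=> bil lcat; split; last by move=> x r t; rewrite /f tcons_balanced lcat.
by split=> x k t u; rewrite /f ?bil.2; [rewrite (tcons_bilin _).1|rewrite (tcons_bilin _).2].
Qed.

Lemma tcat_spec i j :
  [/\ bilin (@tcat i j),
    forall r (t : tpow i) (y : tpow j), tcat (lact r t) y = lact r (tcat t y) &
    forall x (t : tpow i) (y : tpow j), @tcat i.+1 j (tcons x t) y = tcons x (tcat t y)].
Proof.
elim: i => [|i [bil lcat catS]].
  split=> [|r t y|x t y /=]; first exact: lact_bilin; first by rewrite /= lactA.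
  exact: tcons_balanced.
have linS y : linear ((@tcat i.+1 j)^~ y).
  case: i bil lcat catS => [|i] bil lcat _; first exact: (tcons_bilin _).2.
  have [bf balf] := tcat_step bil (fun r t => lcat r t y).
  exact: tensor_lift_linear bf balf.
have linSr x : linear (@tcat i.+1 j x).
  move=> k y z; pose h x := k *: @tcat i.+1 j x y + @tcat i.+1 j x z.
  apply: (@tcons_ext _ _ (fun x => @tcat i.+1 j x (k *: y + z)) h) => [||u t].
  - exact: linS.
  - move=> l u v; rewrite /h !linS !scalerDr !scalerA mulrC addrACA.
    by rewrite [l * k]mulrC.
  - by rewrite /h !catS bil.1 (tcons_bilin _).1.
have lcatS r (t : tpow i.+1) y : @tcat i.+1 j (lact r t) y = lact r (tcat t y).
  apply: (@tcons_ext _ _ (fun t => @tcat i.+1 j (lact r t) y)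
    (fun t => lact r (@tcat i.+1 j t y))) => [||u s].
  - by move=> l u v; rewrite (lact_bilin _).1 linS.
  - by move=> l u v; rewrite linS (lact_bilin _).1.
  - by rewrite lact_tcons !catS lact_tcons.
have bilS : bilin (@tcat i.+1 j) by split.
split=> // x t y.
have [bf balf] := tcat_step bilS (fun r t => lcatS r t y).
exact: tensor_liftE bf balf x t.
Qed.

Lemma tcat_bilin i j : bilin (@tcat i j).
Proof. by case: (tcat_spec i j). Qed.
Lemma tcat_lact i j r (t : tpow i) (y : tpow j) :
  tcat (lact r t) y = lact r (tcat t y).
Proof. by case: (tcat_spec i j). Qed.
Lemma tcat_tcons i j x (t : tpow i) (y : tpow j) :
  @tcat i.+1 j (tcons x t) y = tcons x (tcat t y).
Proof. by case: (tcat_spec i j). Qed.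

Definition tcast i j (e : i = j) : tpow i -> tpow j :=
  fun x => ecast k (tpow k) e x.

Lemma tcast_linear i j (e : i = j) : linear (tcast e).
Proof. by case: j / e. Qed.

Lemma tcast_tcons i j (e : i = j) (e' : i.+1 = j.+1) x (t : tpow i) :
  tcast e' (tcons x t) = tcons x (tcast e t).
Proof. by case: j / e e' => e'; rewrite (eq_irrelevance e' erefl). Qed.

Lemma tcatA i j k (e : (i + (j + k) = i + j + k)%N)
  (x : tpow i) (y : tpow j) (z : tpow k) :
  tcat (tcat x y) z = tcast e (tcat x (tcat y z)).
Proof.
elim: i e x => [|i IHi] e x.
  by rewrite (eq_irrelevance e erefl) /tcast /= tcat_lact.
apply: (@tcons_ext _ _ (fun x => @tcat (i + j).+1 k (@tcat i.+1 j x y) z)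
  (fun x => tcast e (@tcat i.+1 (j + k) x (tcat y z)))) => [||u t].
- exact: lin_comp ((tcat_bilin (i + j).+1 k).2 z) ((tcat_bilin i.+1 j).2 y).
- exact: lin_comp (tcast_linear e) ((tcat_bilin _ _).2 _).
have e' : (i + (j + k) = i + j + k)%N by case: e.
by rewrite !tcat_tcons (tcast_tcons e') -IHi.
Qed.

Lemma tcat1 i (e : (i = i + 0)%N) (x : tpow i) :
  tcat x (1 : tpow 0) = tcast e x.
Proof.
elim: i e x => [|i IHi] e x.
  by rewrite (eq_irrelevance e erefl) /tcast /= mulr1.
apply: (@tcons_ext _ _ (fun x => @tcat i.+1 0 x 1) (tcast e)) => [||u t].
- exact: (tcat_bilin _ _).2.
- exact: tcast_linear.
have e' : (i = i + 0)%N by case: e.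
by rewrite tcat_tcons (tcast_tcons e') -IHi.
Qed.

End TensorPower.

Section TruncatedTensorAlgebra.
Import VectorInternalTheory.
Variables (K : fieldType) (R : falgType K) (M : bimodule R) (n : nat).

(* R (+) M (+) ... (+) M^{(x) n} under concatenation, with the products of    *)
(* total length > n set to zero: the factor of the tensor algebra T_R(M) by   *)
(* the ideal generated by M^{(x) (n + 1)}.                                    *)
Definition ttrunc : Type :=
  dsum (fun i : 'I_n.+1 => tpow M i : lmodType K).
HB.instance Definition _ := GRing.Lmodule.on ttrunc.
Implicit Types u v w : ttrunc.

Fact ttrunc_vect_iso :
  Vector.axiom (\sum_(i < n.+1) dim (tpow M i)) ttrunc.
Proof.
pose c i (x : tpow M i) := v2r x.
exists (fun u => \mxrow_(i < n.+1) c i (dcoord i u)).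
  move=> k u v; apply/mxrowP => i; rewrite mxrowK.
  have -> A B : submxrow (k *: A + B) i = k *: submxrow A i + submxrow B i.
    by apply/matrixP => a b; rewrite !mxE.
  by rewrite !mxrowK /c linearP /= linearP.
exists (fun r => dsum_of (fun i => r2v (submxrow r i))).
  move=> u; apply/dsumP => i; rewrite dsum_ofE mxrowK; exact: v2rK.
by move=> r; apply/mxrowP => i; rewrite mxrowK dsum_ofE /c r2vK.
Qed.
HB.instance Definition _ := Lmodule_hasFinDim.Build K ttrunc ttrunc_vect_iso.

(* The homogeneous element with component x in degree k; zero if k > n. *)
Definition tin k (x : tpow M k) : ttrunc :=
  dsum_of (fun i : 'I_n.+1 => dfwith (fun j => 0 : tpow M j) x i).

Definition ttrunc_mul u v : ttrunc :=
  \sum_(i < n.+1) \sum_(j < n.+1) tin (tcat (dcoord i u) (dcoord j v)).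
Definition ttrunc_one : ttrunc := tin (1 : tpow M 0).

Lemma tin_linear k : linear (@tin k).
Proof.
move=> a x y; apply/dsumP => i; rewrite linearP /= !dsum_ofE /dfwith.
by case: eqP => [e|_]; [exact: (tcast_linear e) | rewrite scaler0 addr0].
Qed.

Lemma tin_tcast k l (e : k = l) (x : tpow M k) : tin (tcast e x) = tin x.
Proof. by case: l / e. Qed.

Lemma tin_out k (x : tpow M k) : (n < k)%N -> tin x = 0.
Proof.
move=> ltnk; apply/dsumP => i; rewrite linear0 dsum_ofE dfwith_out //.
by rewrite neq_ltn (leq_trans _ ltnk) ?orbT.
Qed.

Lemma dcoord_tin (i : 'I_n.+1) (x : tpow M i) : dcoord i (tin x) = x.
Proof. by rewrite dsum_ofE dfwith_in. Qed.

Lemma dcoord_tin_out (i : 'I_n.+1) k (x : tpow M k) :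
  k != i -> dcoord i (tin x) = 0.
Proof. by move=> ki; rewrite dsum_ofE dfwith_out. Qed.

Lemma ttrunc_sum u : u = \sum_i tin (dcoord i u).
Proof.
apply/dsumP => i; rewrite linear_sum (bigD1 i) //= dcoord_tin.
by rewrite big1 ?addr0 // => j ji; rewrite dcoord_tin_out.
Qed.

Lemma ttrunc_ext (P : lmodType K) (g h : ttrunc -> P) : linear g -> linear h ->
  (forall k (x : tpow M k), g (tin x) = h (tin x)) -> g =1 h.
Proof.
move=> lg lh gh u; rewrite (ttrunc_sum u) !lin_sum //.
by apply: eq_bigr => i _; rewrite gh.
Qed.

Lemma ttrunc_mul_bilin : bilin ttrunc_mul.
Proof.
split=> [u k v w|w k u v]; rewrite /ttrunc_mul scaler_sumr -big_split /=;
  apply: eq_bigr => i _; rewrite scaler_sumr -big_split /=;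
  apply: eq_bigr => j _; rewrite linearP -tin_linear; congr tin.
- exact: (tcat_bilin _ _ _).1.
- exact: (tcat_bilin _ _ _).2.
Qed.

Lemma ttrunc_mulE k l (x : tpow M k) (y : tpow M l) :
  ttrunc_mul (tin x) (tin y) = tin (tcat x y).
Proof.
have [ltnk|lekn] := ltnP n k.
  rewrite (tin_out x ltnk) (lin0 (ttrunc_mul_bilin.2 _)) tin_out //.
  exact: leq_trans ltnk (leq_addr _ _).
have [ltnl|leln] := ltnP n l.
  rewrite (tin_out y ltnl) (lin0 (ttrunc_mul_bilin.1 _)) tin_out //.
  exact: leq_trans ltnl (leq_addl _ _).
have tcat0l i j z : @tcat _ _ M i j 0 z = 0 := lin0 ((tcat_bilin M i j).2 z).
have tcat0r i j z : @tcat _ _ M i j z 0 = 0 := lin0 ((tcat_bilin M i j).1 z).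
have tin0 i : @tin i 0 = 0 := lin0 (@tin_linear i).
pose ik : 'I_n.+1 := Ordinal (lekn : (k < n.+1)%N).
pose il : 'I_n.+1 := Ordinal (leln : (l < n.+1)%N).
rewrite /ttrunc_mul (bigD1 ik) //= (bigD1 il) //=.
rewrite (dcoord_tin (i := ik)) (dcoord_tin (i := il)).
rewrite !big1 ?addr0 // => [i ik' | j jl].
  rewrite big1 // => j _; rewrite dcoord_tin_out ?tcat0l ?tin0 //.
  by rewrite eq_sym.
by rewrite (@dcoord_tin_out j) ?tcat0r ?tin0 // eq_sym.
Qed.

Let linl u : linear (ttrunc_mul u) := ttrunc_mul_bilin.1 u.
Let linr u : linear (ttrunc_mul^~ u) := ttrunc_mul_bilin.2 u.

Fact ttrunc_mulA : associative ttrunc_mul.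
Proof.
move=> u v w.
apply: (ttrunc_ext (g := ttrunc_mul^~ (ttrunc_mul v w))
  (h := fun u => ttrunc_mul (ttrunc_mul u v) w)) => [||i x].
- exact: linr.
- exact: lin_comp (linr w) (linr v).
apply: (ttrunc_ext (g := fun v => ttrunc_mul (tin x) (ttrunc_mul v w))
  (h := fun v => ttrunc_mul (ttrunc_mul (tin x) v) w)) => [||j y].
- exact: lin_comp (linl _) (linr w).
- exact: lin_comp (linr w) (linl _).
apply: (ttrunc_ext (g := fun w => ttrunc_mul (tin x) (ttrunc_mul (tin y) w))
  (h := fun w => ttrunc_mul (ttrunc_mul (tin x) (tin y)) w)) => [||k z].
- exact: lin_comp (linl _) (linl _).
- exact: linl.
by rewrite !ttrunc_mulE (tcatA (addnA i j k)) tin_tcast.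
Qed.

Fact ttrunc_mul1 : left_id ttrunc_one ttrunc_mul.
Proof.
apply: (ttrunc_ext (g := ttrunc_mul ttrunc_one) (h := id)) => // i x.
by rewrite ttrunc_mulE /= lact1.
Qed.

Fact ttrunc_1mul : right_id ttrunc_one ttrunc_mul.
Proof.
apply: (ttrunc_ext (g := ttrunc_mul^~ ttrunc_one) (h := id)) => // i x.
by rewrite ttrunc_mulE (tcat1 (esym (addn0 i))) tin_tcast.
Qed.

Fact ttrunc_mulDl : left_distributive ttrunc_mul +%R.
Proof. by move=> u v w; apply: (linD (linr w)). Qed.
Fact ttrunc_mulDr : right_distributive ttrunc_mul +%R.
Proof. by move=> u v w; apply: (linD (linl u)). Qed.
Fact ttrunc_one_neq0 : ttrunc_one != 0.
Proof.
apply/eqP => /(congr1 (dcoord ord0)); rewrite (dcoord_tin (i := ord0)) linear0.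
exact/eqP/oner_neq0.
Qed.

HB.instance Definition _ := GRing.Zmodule_isNzRing.Build ttrunc
  ttrunc_mulA ttrunc_mul1 ttrunc_1mul ttrunc_mulDl ttrunc_mulDr ttrunc_one_neq0.

Fact ttrunc_scaleAl (k : K) u v : k *: (u * v) = k *: u * v.
Proof. by rewrite -(linZ (linr v)). Qed.
Fact ttrunc_scaleAr (k : K) u v : k *: (u * v) = u * (k *: v).
Proof. by rewrite -(linZ (linl u)). Qed.

HB.instance Definition _ :=
  GRing.Lmodule_isLalgebra.Build K ttrunc ttrunc_scaleAl.
HB.instance Definition _ :=
  GRing.Lalgebra_isAlgebra.Build K ttrunc ttrunc_scaleAr.
HB.instance Definition _ := Algebra_isFalgebra.Build K ttrunc.

End TruncatedTensorAlgebra.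

Section LeftDual.
Variables (K : fieldType) (B : falgType K).

(* B^* as a left B-module, b acting by (b f)(c) = f (c b). *)
Definition ldual : Type := 'Hom(B, K^o).
HB.instance Definition _ := GRing.Zmodule.on ldual.

Fact ldual_scaleDr : right_distributive (@dual_lact K B) +%R.
Proof. by move=> b f g; apply: (linD ((dual_lact_bilin B).1 b)). Qed.
Fact ldual_scaleDl (f : ldual) : {morph (@dual_lact K B)^~ f : a b / a + b}.
Proof. exact: (linD ((dual_lact_bilin B).2 f)). Qed.

HB.instance Definition _ := GRing.Zmodule_isLmodule.Build B ldual
  (@dual_lactA K B) (@dual_lact1 K B) ldual_scaleDr ldual_scaleDl.

End LeftDual.

Definition frobenius (K : fieldType) (B : falgType K) : Prop :=
  lmod_iso (ldual B : lmodType B) B^o.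

Definition quasi_frobenius (K : fieldType) (B : falgType K) : Prop :=
  injective_lmod (B^o : lmodType B).

(* For n >= 1, the components are in degrees 0, ..., n - 1. *)
Definition Aalg (K : fieldType) (R : falgType K) (n : nat) : falgType K :=
  ttrunc (dual_bimodule R) n.-1.

Section PrincipalIndecomposables.
Variables (R : nzRingType) (q : nat) (e : 'I_q -> R).

Definition pim_representatives : Prop :=
  [/\ forall i, e i * e i = e i,
      forall i, principal_indecomposable (lideal (e i)),
      forall i j, lmod_iso (lideal (e i)) (lideal (e j)) -> i = j &
      forall P : lmodType R, principal_indecomposable P ->
        exists i, lmod_iso P (lideal (e i))].

Definition pim_multiplicities (m : 'I_q -> nat) : Prop :=
  lmod_iso R^o (dsum (fun i => {ffun 'I_(m i) -> lideal (e i)} : lmodType R)).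

Definition nakayama_permutation (pi : 'S_q) : Prop :=
  forall i, lmod_iso (top (lideal (e i))) (submod (soc (lideal (e (pi i))))).

End PrincipalIndecomposables.

(* Main.v *)
From HB Require Import structures.
From mathcomp Require Import all_boot all_algebra all_fingroup all_field.
From mathcomp Require Import boolp.
Require Import Defs.

(** Write M for the dual bimodule of R, N = n - 1 >= 1, and let
    A = R + M + ... + M^N be the truncated tensor algebra, M^k being the k-th
    tensor power over R.

    An isomorphism of left modules from the dual of A onto A is the same thing
    as a linear form on A whose kernel contains no nonzero left ideal
    ([frobenius_form]).  No nonzero element of M^j is killed by tensoring with
    every element of M, so every nonzero left ideal of A meets the top component
    M^N, where A acts through R: only the values of the form on M^N matter, and
    a linear form on M^N is a left R-linear map from M^N to M.  Hence A is
    Frobenius if and only if M^N embeds into M as a left R-module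
    ([ttrunc_frobenius]).

    It remains to identify the left modules M^k.  Tensoring R e_i with M gives
    M e_i, the dual of e_i R.  Now R e_(pi i) has an essential simple socle
    containing a vector w with e_i w = w ([nakayama_socle]).  A linear form that
    does not kill w yields an embedding of R e_(pi i) into M e_i, which splits
    because R is self-injective, and which is onto because the left
    endomorphisms of M are the right multiplications, while e_i is a primitive
    idempotent ([dual_lideal]).  So M^k is the direct sum of the
    R e_(pi^k(i)), each with multiplicity m_i.  Such decompositions are carried
    along the tensor powers as dual bases ([tcons_dual_basis]).

    Comparing isotypic components of socles, an embedding of M^N into M forces
    m_i <= m_(pi^(N-1)(i)) for all i ([multiplicity_le]); as the two families
    have the same sum, these are equalities.  Conversely, equal multiplicities
    match the two decompositions summand by summand
    ([dual_basis_embedding]). *)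

Set Implicit Arguments.
Unset Strict Implicit.
Unset Printing Implicit Defensive.

Import GRing.Theory.
Local Open Scope ring_scope.

(** * Left ideals generated by idempotents *)

Section LeftIdeals.
Variable R : nzRingType.
Implicit Types (a b c e r s x : R).

Lemma lideal_mem e x : e * e = e ->
  (x \in gen_submod (fun y : R^o => exists r : R, y = r * e)) =
    (x * e == x).
Proof.
move=> ee; apply/idP/eqP => [|xe]; last by apply: mem_gen_submod; exists x.
pose fixe : {pred R^o} := fun y : R => y * e == y.
have fixe_closed : submod_closed fixe.
  split=> [|a y z]; rewrite !unfold_in /fixe ?mul0r // => /eqP ye /eqP ze.
  by rewrite mulrDl ze -[a *: y]/(a * y) -mulrA ye.
pose S : submodClosed R^o :=
  HB.pack fixe (GRing.isSubmodClosed.Build R R^o fixe fixe_closed).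
move/gen_submodP/(_ S) => Sx; apply/eqP/Sx => _ [r ->].
by rewrite unfold_in /= /fixe -mulrA ee.
Qed.

Lemma lideal_valP e (x : lideal e) : e * e = e -> (val x : R) * e = val x.
Proof. by move=> ee; apply/eqP; rewrite -(lideal_mem _ ee) (valP x). Qed.

Lemma lideal_subP e x : e * e = e -> x * e = x ->
  x \in gen_submod (fun x : R^o => exists r : R, x = r * e).
Proof. by move=> ee xe; rewrite lideal_mem ?xe. Qed.

Definition in_lideal e (ee : e * e = e) x (xe : x * e = x) : lideal e :=
  Submod (lideal_subP ee xe).

Lemma lideal_mulP e f a (x : lideal e) : f * f = f -> a * f = a ->
  (val x * a) * f = val x * a.
Proof. by move=> ff af; rewrite -mulrA af. Qed.

Definition lideal_mul e f a (ff : f * f = f) (af : a * f = a) (x : lideal e) :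
  lideal f := in_lideal ff (lideal_mulP x ff af).

Lemma lideal_mul_linear e f a (ff : f * f = f) (af : a * f = a) :
  linear (@lideal_mul e f a ff af).
Proof.
move=> r x y; apply: val_inj; rewrite [RHS]linearP /=.
by rewrite mulrDl -scalerAl.
Qed.

Definition lideal_lin e f a (ff : f * f = f) (af : a * f = a) :
  {linear lideal e -> lideal f} :=
  HB.pack (@lideal_mul e f a ff af)
    (GRing.isLinear.Build R (lideal e) (lideal f) *:%R
      (@lideal_mul e f a ff af) (lideal_mul_linear ff af)).

Lemma lideal_iso e f a b : e * e = e -> f * f = f ->
  a * f = a -> b * e = b -> a * b = e -> b * a = f ->
  lmod_iso (lideal e) (lideal f).
Proof.
move=> ee ff af be ab ba; exists (lideal_lin e ff af).
exists (lideal_mul ee be) => x; apply: val_inj.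
  by rewrite /= -mulrA ab lideal_valP.
by rewrite /= -mulrA ba lideal_valP.
Qed.

Lemma lideal_zero e : e * e = e -> lmod_zero (lideal e) -> e = 0.
Proof. by move=> ee /(_ (in_lideal ee ee)) /(congr1 val). Qed.

(** If c is an idempotent of e R e, then R e is the direct sum of R c and
    R (e - c), so that one of the two summands vanishes. *)
Lemma lideal_primitive e c : e * e = e -> indecomposable_lmod (lideal e) ->
  c * c = c -> e * c = c -> c * e = c -> c = 0 \/ c = e.
Proof.
move=> ee [_ indec] cc ec ce; pose d := e - c.
have dd : d * d = d by rewrite /d mulrBl !mulrBr ee ec ce cc subrr subr0.
have ed : e * d = d by rewrite /d mulrBr ee ec.
have de : d * e = d by rewrite /d mulrBl ee ce.
have cd : c * d = 0 by rewrite /d mulrBr ce cc subrr.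
have dc : d * c = 0 by rewrite /d mulrBl ec cc subrr.
pose h (x : lideal e) : (lideal c * lideal d)%type :=
  (lideal_mul cc cc x, lideal_mul dd dd x).
have lin_h : linear (h : lideal e -> _).
  by move=> r x y; rewrite /h !lideal_mul_linear.
pose hL : {linear lideal e -> (lideal c * lideal d)%type} :=
  HB.pack h (GRing.isLinear.Build R _ _ *:%R h lin_h).
have [|cz|dz] := indec (lideal c) (lideal d).
- exists hL, (fun uv => lideal_mul ee ce uv.1 + lideal_mul ee de uv.2).
    move=> x; apply: val_inj; rewrite /= -!mulrA cc dd -mulrDr.
    by rewrite /d subrKC lideal_valP.
  case=> u v; congr pair; apply: val_inj; rewrite /= !mulrDl.
    by rewrite -!mulrA cc dc mulr0 addr0 lideal_valP.
  by rewrite -!mulrA cd dd mulr0 add0r lideal_valP.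
- by left; apply: lideal_zero.
- by right; apply/esym/eqP; rewrite -subr_eq0 -/d (lideal_zero dd dz).
Qed.

End LeftIdeals.

(** * Nilpotency and the Jacobson radical *)

Section Jacobson.
Variable R : nzRingType.
Implicit Types (r x : R).

Section Closure.
Variable I : submodClosed R^o.

Lemma left_ideal0 : (0 : R) \in I. Proof. exact: rpred0. Qed.
Lemma left_idealD x y : x \in I -> y \in I -> x + y \in I.
Proof. exact: rpredD. Qed.
Lemma left_idealM r x : x \in I -> r * x \in I.
Proof. exact: (@rpredZ _ _ I r x). Qed.

End Closure.

(** If x lay outside a maximal left ideal I, then 1 - r x would lie in I for
    some r; but this element is a unit as r x is nilpotent. *)
Lemma nil_in_jacobson x :
  (forall r, exists k, (r * x) ^+ k = 0) -> in_jacobson x.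
Proof.
move=> nilx I [I_proper maxI]; apply: contraT => xI.
pose P : {pred R^o} := fun y : R => `[< exists r, y - r * x \in I >].
have P_closed : submod_closed P.
  split=> [|a y z]; rewrite !unfold_in /P.
    by apply/asboolP; exists 0; rewrite mul0r subrr left_ideal0.
  move=> /asboolP[r yI] /asboolP[s zI]; apply/asboolP; exists (a * r + s).
  rewrite -[a *: y]/(a * y) mulrDl -mulrA opprD addrACA -mulrBr.
  by rewrite left_idealD ?left_idealM.
pose S : submodClosed R^o :=
  HB.pack P (GRing.isSubmodClosed.Build R R^o P P_closed).
have IS : {subset I <= S}.
  by move=> y yI; apply/asboolP; exists 0; rewrite mul0r subr0.
have [SI|ST] := maxI S IS.
  case/negP: xI; rewrite -SI; apply/asboolP; exists 1.
  by rewrite mul1r subrr left_ideal0.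
have /asboolP[r rI] : (1 : R) \in S by rewrite ST.
case: I_proper => y; rewrite [RHS]inE.
have [k rxk0] := nilx r.
rewrite -[y]mulr1 left_idealM //.
suff <- : (\sum_(i < k) (r * x) ^+ i) * (1 - r * x) = 1.
  exact: left_idealM.
rewrite -[LHS]opprK -mulrN opprB -(commr_sum _ (x := r * x - 1)); last first.
  move=> i _; apply/commrX/commr_sym/commrB; last exact: commr1.
  exact: commr_refl.
by rewrite -subrX1 rxk0 sub0r opprK.
Qed.

End Jacobson.

Section Fitting.
Variables (K : fieldType) (R : falgType K).
Implicit Types (e r s x y z : R).

(** R e has a unique maximal submodule when it is indecomposable. If R x is not
    a nil left ideal, then e R e contains a non nilpotent z = e r x. By
    Fitting's argument, R z^k does not depend on k for large k, and right
    multiplication by y = z^k is bijective on R y; the element u of R y such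
    that u y = y is then a nonzero idempotent of e R e, hence equal to e. *)
Lemma lideal_gen_or_jacobson e x :
  e * e = e -> indecomposable_lmod (lideal e) -> x * e = x ->
  (exists s, e = s * x) \/ in_jacobson x.
Proof.
move=> ee indec xe.
have [nilx|] := pselect (forall r, exists k, (r * x) ^+ k = 0).
  by right; apply: nil_in_jacobson.
move=> /existsNP[r /forallNP nnil]; left.
pose z := e * (r * x).
have ez : e * z = z by rewrite /z mulrA ee.
have ze : z * e = z by rewrite /z -!mulrA xe.
have zXe k : r * x * z ^+ k * e = r * x * z ^+ k.
  case: k => [|k]; first by rewrite mulr1 -mulrA xe.
  by rewrite exprSr [in LHS]mulrA -[LHS]mulrA ze mulrA.
have rzX k : (r * x) ^+ k.+1 = r * x * z ^+ k.
  elim: k => [|k IHk]; first by rewrite mulr1.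
  by rewrite exprSr IHk -{1}zXe -mulrA -/z exprSr mulrA.
have z_nnil k : z ^+ k != 0.
  by apply/eqP => zk0; apply: (nnil k.+1); rewrite rzX zk0 mulr0.
pose rk y := \dim (limg (amulr y)).
have amulrE y s : amulr y s = s * y by rewrite lfunE.
(* k is chosen so that the left ideal R z^(k+1) has minimal dimension. *)
pose P d := `[< exists k, rk (z ^+ k.+1) = d >].
have exP : exists d, P d by exists (rk (z ^+ 1)); apply/asboolP; exists 0%N.
case: (ex_minnP exP) => d /asboolP[k rkd] mind; set y := z ^+ k.+1 in rkd.
have yy : y * y = z ^+ (k + k).+1.+1 by rewrite -exprD addSn addnS.
have imyy : limg (amulr (y * y)) = (amulr y @: limg (amulr y))%VS.
  rewrite -limg_comp; suff -> : (amulr y \o amulr y)%VF = amulr (y * y) by [].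
  by apply/lfunP => s; rewrite comp_lfunE !amulrE mulrA.
have dimyy : \dim (limg (amulr (y * y))) = \dim (limg (amulr y)).
  apply/eqP; rewrite eqn_leq; apply/andP; split.
    by rewrite imyy -[leqRHS](limg_ker_dim (amulr y)) leq_addl.
  rewrite [leqLHS]rkd.
  by apply: mind; apply/asboolP; exists (k + k).+1; rewrite /rk yy.
have injy s t : s * y * y = t * y * y -> s * y = t * y.
  move=> sty; apply/eqP; rewrite -subr_eq0 -mulrBl -memv0.
  have := limg_ker_dim (amulr y) (limg (amulr y)).
  rewrite -imyy dimyy -[RHS]add0n => /addIn/eqP; rewrite dimv_eq0 => /eqP <-.
  rewrite memv_cap memv_ker !amulrE -[(s - t) * y]amulrE memv_img ?memvf //=.
  by rewrite amulrE mulrBl mulrBl sty subrr.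
(* The idempotent u of the Fitting decomposition is s y. *)
have: y \in limg (amulr (y * y)).
  have /eqP -> : limg (amulr (y * y)) == limg (amulr y).
    rewrite eqEdim dimyy leqnn andbT; apply/subvP => _ /memv_imgP[s _ ->].
    by rewrite amulrE mulrA -amulrE memv_img ?memvf.
  by rewrite -[X in X \in _]mul1r -amulrE memv_img ?memvf.
case/memv_imgP => s _; rewrite amulrE mulrA => ys.
have sK a : a * s * y * y = a * y by rewrite -!mulrA (mulrA s) -ys.
have ye : y * e = y by rewrite /y exprSr -mulrA ze.
have ey : e * y = y by rewrite /y exprS mulrA ez.
have uu : s * y * (s * y) = s * y by rewrite mulrA; apply: injy; rewrite sK ys.
have eu : e * (s * y) = s * y by rewrite mulrA; apply: injy; rewrite sK ey.
have ue : s * y * e = s * y by rewrite -mulrA ye.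
case: (lideal_primitive ee indec uu eu ue) => [u0 | <-].
  by case/eqP: (z_nnil k.+1); rewrite -/y ys u0 mul0r.
by exists (s * z ^+ k * e * r); rewrite /y exprSr /z !mulrA.
Qed.

End Fitting.

(** * The socle of an indecomposable summand *)

Section Socle.
Variables (K : fieldType) (R : falgType K).
Implicit Types (e f r s x y z : R).

(** One takes y such that R y has minimal dimension among the nonzero R (r x). *)
Lemma exists_minimal_multiple x : x != 0 ->
  exists2 y, y != 0 & (exists r, y = r * x) /\
    forall s, s * y != 0 -> exists t, y = t * (s * y).
Proof.
move=> x0; have amulrE y s : amulr y s = s * y by rewrite lfunE.
pose P d := `[< exists y,
  [/\ y != 0, exists r, y = r * x & \dim (limg (amulr y)) = d] >].
have exP : exists d, P d.
  exists (\dim (limg (amulr x))); apply/asboolP; exists x; split=> //.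
  by exists 1; rewrite mul1r.
case: (ex_minnP exP) => d /asboolP[y [y0 [r yE] <-]] mind.
exists y => //; split=> [|s sy0]; first by exists r.
have /eqP sub : limg (amulr (s * y)) == limg (amulr y).
  rewrite eqEdim; apply/andP; split.
    apply/subvP => _ /memv_imgP[t _ ->].
    by rewrite amulrE mulrA -amulrE memv_img ?memvf.
  apply: mind; apply/asboolP; exists (s * y); split=> //.
  by exists (s * r); rewrite yE mulrA.
have : y \in limg (amulr (s * y)).
  by rewrite sub -[X in X \in _]mul1r -amulrE memv_img ?memvf.
by case/memv_imgP => t _; rewrite amulrE; exists t.
Qed.

Lemma minimal_in_soc f y (ff : f * f = f) (yf : y * f = y) : y != 0 ->
  (forall s, s * y != 0 -> exists t, y = t * (s * y)) ->
  in_lideal ff yf \in soc (lideal f).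
Proof.
move=> y0 miny.
pose P : {pred lideal f} := fun u => `[< exists s, (val u : R) = s * y >].
have P_closed : submod_closed P.
  split=> [|a u v]; rewrite !unfold_in /P.
    by apply/asboolP; exists 0; rewrite mul0r.
  move=> /asboolP[s uE] /asboolP[t vE]; apply/asboolP; exists (a * s + t).
  by rewrite mulrDl -mulrA -uE -vE.
pose S : submodClosed (lideal f) :=
  HB.pack P (GRing.isSubmodClosed.Build R (lideal f) P P_closed).
have yS : in_lideal ff yf \in S by apply/asboolP; exists 1; rewrite mul1r.
apply: mem_gen_submod; exists S => //; split.
  by move=> /(_ (Submod yS)) /(congr1 val) /(congr1 val)/eqP; rewrite (negPf y0).
move=> T; have [T0|/existsNP[u /not_implyP[uT u0]]] :=
  pselect (forall u, u \in T -> u = 0).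
  left=> u; rewrite [RHS]inE; apply/idP/eqP => [/T0//|->]; exact: rpred0.
right=> v; rewrite [RHS]inE.
have /asboolP[s uE] := valP u; have /asboolP[t vE] := valP v.
have sy0 : s * y != 0.
  rewrite -uE; apply/eqP => uu0; apply: u0; exact/val_inj/val_inj.
have [a yE] := miny s sy0.
have -> : v = (t * a) *: u.
  by apply/val_inj/val_inj; rewrite /= vE yE -uE -[RHS]mulrA.
exact: rpredZ.
Qed.

(** The vector w corresponds to the class of e in the top of R e. Any nonzero
    x in R f has a multiple y in the socle, which corresponds to the class of
    some z in R e. As this class is not zero, z is not in the radical, so that z
    generates R e, and y generates w. In particular the socle of R f is simple
    and essential. *)
Lemma nakayama_socle e f : e * e = e -> f * f = f -> f != 0 ->
  indecomposable_lmod (lideal e) ->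
  lmod_iso (top (lideal e)) (submod (soc (lideal f))) ->
  exists w, [/\ w != 0, w * f = w, e * w = w,
    forall a, in_jacobson a -> a * w = 0 &
    forall x, x * f = x -> x != 0 -> exists r, w = r * x].
Proof.
move=> ee ff f0 indec [phi [psi phiK psiK]].
pose e' := in_lideal ee ee.
pose cl (u : lideal e) : top (lideal e) := quo_pi (rad (lideal e)) u.
pose elt (u : submod (soc (lideal f))) : R := submod_val (submod_val u).
have clZ a u : cl (a *: u) = a *: cl u.
  exact: (linearZ_LR (quo_pi (rad (lideal e)))).
have eltZ a u : elt (a *: u) = a * elt u by [].
have phiZ a u : phi (a *: u) = a *: phi u by exact: (linearZ_LR phi).
have clE (u : lideal e) : cl u = (val u : R) *: cl e'.
  by rewrite -clZ; congr cl; apply: val_inj; rewrite /= [RHS](lideal_valP u ee).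
have cl_jac a (u : lideal e) : in_jacobson a -> cl (a *: u) = 0.
  move=> aJ; rewrite /cl -(raddf0 (quo_pi (rad (lideal e)))).
  by apply/quo_piP; rewrite subr0; apply: mem_gen_submod; exists a, u.
have phi0 : elt (phi 0) = 0.
  by rewrite -(scale0r (0 : top (lideal e))) phiZ eltZ mul0r.
pose w := elt (phi (cl e')).
have wE (u : lideal e) : elt (phi (cl u)) = (val u : R) * w.
  by rewrite clE phiZ eltZ.
have key x : x * f = x -> x != 0 ->
    exists r s, [/\ w = r * x & s * w != 0].
  move=> xf x0; have [y y0 [[r yE] miny]] := exists_minimal_multiple x0.
  have yf : y * f = y by rewrite yE -mulrA xf.
  pose y' : submod (soc (lideal f)) := Submod (minimal_in_soc ff yf y0 miny).
  pose z : lideal e := quo_repr (psi y').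
  have zE : psi y' = cl z by rewrite /cl quo_reprK.
  have zw : (val z : R) * w = y by rewrite -wE -zE psiK.
  have [[s es]|zJ] := lideal_gen_or_jacobson ee indec (lideal_valP z ee).
    exists (s * r), (val z : R); split; last by rewrite zw.
    by rewrite -mulrA -yE -zw mulrA -es -[e]/(val e' : R) -wE.
  by move/eqP: (y0); case; rewrite -zw -eltZ -phiZ -clZ cl_jac.
exists w; split.
- have [_ [s [_]]] := key f ff f0; by apply: contraNneq => ->; rewrite mulr0.
- exact: lideal_valP.
- by rewrite -[e]/(val e' : R) -wE.
- by move=> a aJ; rewrite /w -eltZ -phiZ -clZ cl_jac.
- by move=> x xf x0; have [r [_ [-> _]]] := key x xf x0; exists r.
Qed.

End Socle.

(** * The dual bimodule *)

Section Dual.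
Variables (K : fieldType) (R : falgType K).
Notation dual := 'Hom(R, K^o).
Implicit Types (e r s x y : R) (h : dual).

Lemma linfunE (f : R -> K^o) (lf : linear f) : linfun f =1 f.
Proof. exact: (lfunE (mklin lf)). Qed.

Let b (i : 'I_(\dim {:R})) := (vbasis {:R})`_i.
Let bc (i : 'I_(\dim {:R})) : dual := linfun (coord (vbasis {:R}) i : R -> K^o).

Let basisE x : x = \sum_i bc i x *: b i.
Proof.
rewrite {1}(coord_vbasis (memvf x)); apply: eq_bigr => i _.
by rewrite /bc lfunE.
Qed.

Lemma dual_separates x : (forall h, h x = 0) -> x = 0.
Proof.
by move=> hx0; rewrite [x]basisE big1 // => i _; rewrite hx0 scale0r.
Qed.

Lemma dual_separatesP x : x != 0 -> exists h : dual, h x != 0.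
Proof.
move=> x0; apply: contrapT => /forallNP nh; case/eqP: x0.
by apply: dual_separates => h; apply/eqP/negPn/negP/nh.
Qed.

Lemma dual_reflexive (l : dual -> K^o) : linear l ->
  exists c, forall h, l h = h c.
Proof.
move=> lin_l; exists (\sum_i l (bc i) *: b i) => h.
have hE : h = \sum_i h (b i) *: bc i.
  apply/lfunP => x; rewrite {1}[x]basisE linear_sum sum_lfunE.
  by apply: eq_bigr => i _; rewrite linearZ scale_lfunE; apply: mulrC.
rewrite {1}hE lin_sum // linear_sum; apply: eq_bigr => i _.
by rewrite linZ // linearZ; apply: mulrC.
Qed.

(** The form h |-> (p h)(1) is the evaluation at some c by reflexivity, and left
    linearity recovers p from it. *)
Lemma dual_endomorphism (p : dual -> dual) : linear p ->
  (forall r h, p (dual_lact r h) = dual_lact r (p h)) ->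
  exists c, forall h, p h = dual_ract h c.
Proof.
move=> lin_p lact_p.
have [c cE] : exists c, forall h, p h 1 = h c.
  apply: (dual_reflexive (l := fun h => p h 1)) => k h h'.
  by rewrite lin_p add_lfunE scale_lfunE.
exists c => h; apply/lfunP => s.
by rewrite dual_ractE -dual_lactE -cE lact_p dual_lactE mul1r.
Qed.

(** The maps x |-> x phi and g are inverse isomorphisms between R f and M e,
    where M is the dual of R. Defining g on the whole of M makes (phi, g) usable
    as a part of a dual basis of a tensor product with M. *)
Definition dual_summand e f (phi : dual) (g : dual -> R) : Prop :=
  [/\ dual_ract phi e = phi, dual_lact f phi = phi, linear g,
      forall r h, g (dual_lact r h) = r * g h &
      [/\ forall h, g h * f = g h, g phi = f &
          forall h, dual_ract h e = h -> dual_lact (g h) phi = h]].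

(** A form that does not kill the socle vector w gives an embedding Phi of R f
    into M e. Self-injectivity of R extends the inverse of Phi to g, so
    that p = Phi g is a projection of M onto the image of Phi. It is the right
    multiplication by some c, for which e c is a nonzero idempotent of e R e,
    hence e: the image of Phi is all of M e. *)
Lemma dual_lideal e f w : quasi_frobenius R ->
  e * e = e -> f * f = f -> indecomposable_lmod (lideal e) ->
  w != 0 -> w * f = w -> e * w = w ->
  (forall x, x * f = x -> x != 0 -> exists r, w = r * x) ->
  exists phi g, dual_summand e f phi g.
Proof.
move=> qf ee ff indec w0 wf ew w_min.
have [lam lamw] := dual_separatesP w0.
have lin_phi : linear (fun s => lam (e * s * f) : K^o).
  by move=> k x y; rewrite mulrDr mulrDl -scalerAr -scalerAl linearP.
pose phi : dual := linfun (fun s => lam (e * s * f) : K^o).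
have phiE s : phi s = lam (e * s * f) by rewrite (linfunE lin_phi).
have phie : dual_ract phi e = phi.
  by apply/lfunP => s; rewrite dual_ractE !phiE mulrA ee.
have fphi : dual_lact f phi = phi.
  by apply/lfunP => s; rewrite dual_lactE !phiE -!mulrA ff.
have phiw : phi w != 0 by rewrite phiE ew wf.
pose Phi (u : lideal f) : ldual R := dual_lact (val u : R) phi.
have lin_Phi : linear Phi.
  move=> r u v; rewrite /Phi.
  rewrite -[val (r *: u + v)]/(r * (val u : R) + (val v : R)).
  by rewrite (linD ((dual_lact_bilin R).2 phi)) -dual_lactA.
pose PhiL : {linear lideal f -> ldual R} :=
  HB.pack Phi (GRing.isLinear.Build R (lideal f) (ldual R) *:%R Phi lin_Phi).
have inj_Phi : injective PhiL.
  apply: raddf_inj => u; move/lfunP => Phiu0; apply: val_inj.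
  apply/eqP; apply: contraT => u0.
  have [r wE] := w_min _ (lideal_valP u ff) u0.
  case/eqP: phiw; rewrite wE -dual_lactE.
  by rewrite -[dual_lact _ _]/(PhiL u) Phiu0 zero_lfunE.
pose vL : {linear lideal f -> R^o} :=
  HB.pack (fun u : lideal f => val u : R^o)
    (GRing.isLinear.Build R (lideal f) R^o *:%R
      (fun u : lideal f => val u : R^o) (fun r u v => erefl)).
have [g0 g0E] := qf _ _ PhiL vL inj_Phi.
pose g (h : dual) : R := (g0 h : R) * f.
have lactK k h : dual_lact k%:A h = k *: h.
  by rewrite (linZ ((dual_lact_bilin R).2 h)) dual_lact1.
have gM r h : g (dual_lact r h) = r * g h.
  by rewrite /g mulrA; congr (_ * _); exact: (linearZ_LR g0 r h).
have gD h h' : g (h + h') = g h + g h'.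
  by rewrite /g -mulrDl; congr (_ * _); exact: (raddfD g0 h h').
have lin_g : linear g.
  by move=> k h h'; rewrite gD -lactK gM -scalerAl mul1r.
have gf h : g h * f = g h by rewrite /g -mulrA ff.
have gphi : g phi = f.
  have := g0E (in_lideal ff ff); rewrite /= /Phi /= fphi /g => ->.
  exact: ff.
exists phi, g; split=> //; split=> // h he.
pose p h : dual := dual_lact (g h) phi.
have lin_p : linear p.
  by move=> k h1 h2; rewrite /p lin_g (dual_lact_bilin R).2.
have lact_p r h1 : p (dual_lact r h1) = dual_lact r (p h1).
  by rewrite /p gM dual_lactA.
have [c cE] := dual_endomorphism lin_p lact_p.
have eq_ract s t : (forall h, dual_ract h s = dual_ract h t) -> s = t.
  move=> st; apply/eqP; rewrite -subr_eq0; apply/eqP/dual_separates => h1.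
  rewrite linearB /= -[s]mulr1 -[t]mulr1 -!dual_ractE st; exact: subrr.
have ce : c * e = c.
  by apply: eq_ract => h1; rewrite -dual_ractA -cE /p dual_lractA phie.
have cc : c * c = c.
  by apply: eq_ract => h1; rewrite -dual_ractA -!cE {1}/p {1}/p gM gphi gf.
have ecec : e * c * (e * c) = e * c by rewrite mulrA -(mulrA e c) ce -mulrA cc.
have eec : e * (e * c) = e * c by rewrite mulrA ee.
have ece : e * c * e = e * c by rewrite -mulrA ce.
have [ec0|ec] := lideal_primitive ee indec ecec eec ece.
  have phi0 : phi = 0.
    rewrite -fphi -gphi -/(p phi) cE -cc -{1}ce -mulrA ec0 mulr0.
    exact: (lin0 ((dual_ract_bilin R).1 phi)).
  by case/eqP: phiw; rewrite phi0 zero_lfunE.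
by rewrite -/(p h) cE -he dual_ractA ec.
Qed.

End Dual.

(** * Frobenius forms *)

Lemma dim_limg_injective (K : fieldType) (U V : vectType K) (f : U -> V) :
  linear f -> (forall u, f u = 0 -> u = 0) -> \dim (limg (linfun f)) = dim U.
Proof.
move=> lin_f inj_f; have fE u : linfun f u = f u := lfunE (mklin lin_f) u.
have ker0 : lker (linfun f) = 0%VS.
  apply/eqP; rewrite -subv0; apply/subvP => u.
  by rewrite memv_ker fE memv0 => /eqP/inj_f ->.
by have := limg_ker_dim (linfun f) fullv; rewrite ker0 capv0 dimv0 add0n dimvf.
Qed.

Lemma injective_dim_le (K : fieldType) (U V : vectType K) (f : U -> V) :
  linear f -> (forall u, f u = 0 -> u = 0) -> (dim U <= dim V)%N.
Proof.
move=> lin_f inj_f; rewrite -(dim_limg_injective lin_f inj_f) -dimvf.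
exact/dimvS/subvf.
Qed.

Section FrobeniusForm.
Variables (K : fieldType) (B : falgType K).

(** The form is the inverse image of 1; conversely u |-> u lam is an injection
    between spaces of the same dimension. *)
Lemma frobenius_form : frobenius B <->
  exists lam : 'Hom(B, K^o), forall u, (forall v : B, lam (v * u) = 0) -> u = 0.
Proof.
split=> [[G [F GK FK]] | [lam lam_nondeg]].
  have G0 f : G f = 0 -> f = 0 by rewrite -(raddf0 G) => /(can_inj GK).
  exists (F 1) => u u0.
  have Fu : F u = dual_lact (u : B) (F 1).
    apply: (can_inj GK); rewrite FK.
    rewrite -[dual_lact _ _]/(u *: (F 1 : ldual B)) (linearZ_LR G) /= FK.
    by rewrite -[RHS]/(u * 1) mulr1.
  rewrite -[u]FK Fu; rewrite -(raddf0 G); congr (G _).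
  by apply/lfunP => v; rewrite dual_lactE zero_lfunE u0.
pose F (u : B) : ldual B := dual_lact u lam.
have lin_F : linear (F : B^o -> ldual B).
  by move=> a u v; rewrite /F (linD ((dual_lact_bilin B).2 lam)) -dual_lactA.
pose fF : 'Hom(B, 'Hom(B, K^o)) := linfun (F : B -> 'Hom(B, K^o)).
have lin_FK : linear (F : B -> 'Hom(B, K^o)) := (dual_lact_bilin B).2 lam.
have fFE u : fF u = F u := lfunE (mklin lin_FK) u.
have F_inj u : F u = 0 -> u = 0.
  move=> Fu0; apply: lam_nondeg => v.
  by rewrite -dual_lactE -[dual_lact _ _]/(F u) Fu0 zero_lfunE.
have im_full : limg fF = fullv.
  apply/eqP; rewrite eqEdim subvf (dim_limg_injective lin_FK) //.
  by rewrite dimvf /dim /= muln1.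
have /choice[G GE] (f : ldual B) : exists u, F u = f.
  have : (f : 'Hom(B, K^o)) \in limg fF by rewrite im_full memvf.
  by case/memv_imgP => u _ ->; exists u; rewrite fFE.
have FK : cancel F G.
  move=> u; apply/eqP; rewrite -subr_eq0; apply/eqP/F_inj.
  by rewrite /F (linB ((dual_lact_bilin B).2 lam)) -/(F _) -/(F _) GE subrr.
have lin_G : linear (G : ldual B -> B^o).
  by move=> a f g; apply: (can_inj FK); rewrite lin_F !GE.
pose GL : {linear ldual B -> B^o} :=
  HB.pack (G : ldual B -> B^o)
    (GRing.isLinear.Build B _ _ *:%R (G : ldual B -> B^o) lin_G).
by exists GL, F.
Qed.

End FrobeniusForm.

(** * Truncated tensor algebras that are Frobenius *)

Section FrobeniusCriterion.
Variables (K : fieldType) (R : falgType K) (M : bimodule R) (N : nat).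
Notation dual := 'Hom(R, K^o).

Lemma tcast_eq0 i j (e : i = j) (x : tpow M i) : tcast e x = 0 -> x = 0.
Proof. by case: j / e. Qed.

Lemma tcast_lact i j (e : i = j) r (x : tpow M i) :
  tcast e (lact r x) = lact r (tcast e x).
Proof. by case: j / e. Qed.

(** One cancels the k factors of the left operand one by one, starting from the
    outermost. *)
Lemma tcat_eq0 k i (y : tpow M i) :
  (forall j (z : tpow M j), (j < k + i)%N ->
     (forall x, tcons x z = 0) -> z = 0) ->
  (forall z : tpow M k, tcat z y = 0) -> y = 0.
Proof.
elim: k => [|k IHk] faithful zy0; first by have := zy0 1; rewrite /= lact1.
apply: IHk => [j z ltj | t]; first by apply: faithful; rewrite addSn ltnW.
by apply: (faithful (k + i)%N) => // x; rewrite -tcat_tcons zy0.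
Qed.

(** A form lam on the algebra and a map Psi on its top component determine each
    other on M^N by lam (r x) = (Psi x)(r). The left ideal generated by x in M^N
    is R x, so Psi is injective when lam is nondegenerate. Conversely, if the
    left ideal generated by u lies in the kernel of lam, then the component of
    lowest degree i of u is killed by the left concatenation with M^(N-i), since
    the components of higher degree are pushed beyond degree N; hence it is
    zero. *)
Lemma ttrunc_frobenius :
  (forall j (z : tpow M j), (j < N)%N -> (forall x, tcons x z = 0) -> z = 0) ->
  frobenius (ttrunc M N) <->
  exists Psi : tpow M N -> dual,
    [/\ linear Psi, forall r x, Psi (lact r x) = dual_lact r (Psi x) &
        forall x, Psi x = 0 -> x = 0].
Proof.
move=> faithful; rewrite frobenius_form.
have mulE k l (x : tpow M k) (y : tpow M l) :
  (tin N x : ttrunc M N) * tin N y = tin N (tcat x y) := ttrunc_mulE N x y.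
split=> [[lam lam_nondeg] | [Psi [lin_Psi Psi_lact Psi_inj]]].
  have lin_form (x : tpow M N) : linear (fun r => lam (tin N (lact r x)) : K^o).
    by move=> k r s; rewrite (lact_bilin _).2 tin_linear linearP.
  pose Psi (x : tpow M N) : dual :=
    linfun (fun r => lam (tin N (lact r x)) : K^o).
  have PsiE x r : Psi x r = lam (tin N (lact r x)).
    by rewrite (linfunE (lin_form x)).
  exists Psi; split.
  - move=> k x y; apply/lfunP => r; rewrite add_lfunE scale_lfunE !PsiE.
    by rewrite (lact_bilin _).1 tin_linear linearP.
  - by move=> r x; apply/lfunP => s; rewrite dual_lactE !PsiE lactA.
  move=> x Psix0.
  suff tx0 : tin N x = 0 :> ttrunc M N.
    by rewrite -(dcoord_tin (i := ord_max) x) tx0 linear0.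
  apply: lam_nondeg => v.
  have top0 (k : nat) (z : tpow M k) : lam ((tin N z : ttrunc M N) * tin N x) = 0.
    rewrite mulE; case: k z => [|k] z; last first.
      by rewrite tin_out ?linear0 // addSn ltnS leq_addl.
    by rewrite -PsiE Psix0 zero_lfunE.
  rewrite (ttrunc_sum v) mulr_suml linear_sum big1 // => i _; exact: top0.
have lin_lam : linear (fun u : ttrunc M N => Psi (dcoord ord_max u) 1 : K^o).
  by move=> k u v; rewrite linearP lin_Psi add_lfunE scale_lfunE.
exists (linfun (fun u : ttrunc M N => Psi (dcoord ord_max u) 1 : K^o)).
move=> u u0.
have coord0 k (i : 'I_N.+1) : (i < k)%N -> dcoord i u = 0.
  elim: k i => [//|k IHk] i; rewrite ltnS => lei.
  have lti := ltn_ord i; have e : (N - i + i = N)%N by rewrite subnK.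
  apply: (@tcat_eq0 (N - i) i); first by move=> j z; rewrite e; apply: faithful.
  move=> z; suff tz0 : tcast e (tcat z (dcoord i u)) = 0.
    exact: tcast_eq0 tz0.
  apply: Psi_inj; apply/lfunP => r; rewrite zero_lfunE.
  have := u0 (tin N (lact r z)); rewrite (linfunE lin_lam) => <-.
  have -> : (tin N (lact r z) : ttrunc M N) * u =
      tin N (tcast e (tcat (lact r z) (dcoord i u))).
    rewrite tin_tcast [X in _ * X]ttrunc_sum mulr_sumr (bigD1 i) //= mulE.
    rewrite big1 ?addr0 // => j ji; rewrite mulE.
    have [ltji|leij] := ltnP j i.
      rewrite (IHk j (leq_trans ltji lei)) (lin0 ((tcat_bilin M _ j).1 _)).
      exact: (lin0 (@tin_linear _ _ _ _ _)).
    rewrite tin_out //.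
    by rewrite -{1}e ltn_add2l ltn_neqAle leij andbT eq_sym.
  rewrite (dcoord_tin (i := ord_max)) tcat_lact.
  by rewrite tcast_lact Psi_lact dual_lactE mul1r.
by apply/dsumP => i; rewrite linear0 (coord0 N.+1 i).
Qed.

End FrobeniusCriterion.

(** * Direct sum decompositions as dual bases *)

Section DualBasis.
Variables (K : fieldType) (R : falgType K) (T : finType).

(** For idempotents eps a, this says that X is the direct sum over a of left
    modules R (eps a): the vectors x a are the images of the generators eps a,
    and the maps p a are the coordinates. *)
Definition dual_basis (X : bimodule R) (eps : T -> R) (x : T -> X)
    (p : T -> X -> R) : Prop :=
  [/\ forall a, linear (p a), forall a r y, p a (lact r y) = r * p a y,
      forall a y, p a y * eps a = p a y,
      forall a b, p a (x b) = if a == b then eps a else 0 &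
      forall y, y = \sum_a lact (p a y) (x a)].

Definition has_dual_basis (X : bimodule R) (eps : T -> R) : Prop :=
  exists x p, @dual_basis X eps x p.

(** The universal property of the tensor product for [tcons], in the uniform
    shape that includes the case where the second factor is R. *)
Lemma tcons_lift (M : bimodule R) (P : lmodType K) j
    (f : M -> tpow M j -> P) : bilin f ->
  (forall x r y, f (ract x r) y = f x (lact r y)) ->
  exists2 h : tpow M j.+1 -> P, linear h & forall x y, h (tcons x y) = f x y.
Proof.
case: j f => [|j] f bil bal; last first.
  exists (tensor_lift f); first exact: tensor_lift_linear.
  exact: tensor_liftE.
exists (fun x => f x 1); first exact: bil.2.
by move=> x y; rewrite bal /= mulr1.
Qed.

(** The coordinate c = p a y satisfies h c = 0 in M for all h, because
    h (x) y |-> h (p a y) is well defined; and (h c)(1) = h(c). *)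
Lemma tcons_dual_eq0 j (eps : T -> R) (y : tpow (dual_bimodule R) j) :
  has_dual_basis (tpow (dual_bimodule R) j) eps ->
  (forall h : dual_bimodule R, tcons h y = 0) -> y = 0.
Proof.
move=> [x [p [lin_p lact_p _ _ yE]]] hy0.
rewrite [LHS]yE big1 // => a _.
suff -> : p a y = 0 by exact: (lin0 ((lact_bilin _).2 (x a))).
apply: dual_separates => h.
pose f (h : dual_bimodule R) (z : tpow (dual_bimodule R) j) : dual_bimodule R :=
  ract h (p a z).
have bil : bilin f.
  split=> z k u v; rewrite /f; last exact: (ract_bilin _).2.
  by rewrite lin_p (ract_bilin _).1.
have bal u r z : f (ract u r) z = f u (lact r z) by rewrite /f lact_p ractA.
have [F lin_F FE] := tcons_lift bil bal.
have : f h y = 0 by rewrite -FE hy0 (lin0 lin_F).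
move=> /lfunP/(_ 1); rewrite /f /= dual_ractE mulr1 => ->; exact: zero_lfunE.
Qed.

(** Tensoring the summand R (eps a) with M gives M (eps a), which is isomorphic
    to R (eps' a): the new vectors are phi a (x) x a, with coordinates
    h (x) z |-> g a (h (p a z)). *)
Lemma tcons_dual_basis j (eps eps' : T -> R) :
  (forall a, exists phi g, dual_summand (eps a) (eps' a) phi g) ->
  has_dual_basis (tpow (dual_bimodule R) j) eps ->
  has_dual_basis (tpow (dual_bimodule R) j.+1) eps'.
Proof.
set M := dual_bimodule R => /choice[phi /choice[g gP]].
move=> [x [p [lin_p lact_p p_eps p_x yE]]].
pose f a (h : M) (z : tpow M j) : R := g a (ract h (p a z)).
have bil a : bilin (f a).
  have [_ _ lin_g _ _] := gP a.
  split=> z k u v; rewrite /f.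
    by rewrite lin_p (ract_bilin _).1 lin_g.
  by rewrite (ract_bilin _).2 lin_g.
have bal a u r z : f a (ract u r) z = f a u (lact r z).
  by rewrite /f lact_p ractA.
have P_ex a : {P : tpow M j.+1 -> R |
    linear P /\ forall u v, P (tcons u v) = f a u v}.
  by apply: cid; have [F] := tcons_lift (bil a) (bal a); exists F.
pose p' a := sval (P_ex a).
have lin_p' a : linear (p' a) by case: (svalP (P_ex a)).
have p'E a u v : p' a (tcons u v) = f a u v by have [_] := svalP (P_ex a); apply.
exists (fun a => tcons (phi a : M) (x a)), p'; split=> //.
- move=> a r; apply: tcons_ext => [||u t].
  + exact: lin_comp (lin_p' a) ((lact_bilin _).1 r).
  + by move=> k u v; rewrite lin_p' mulrDr scalerAr.
  + have [_ _ _ gM _] := gP a.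
    by rewrite lact_tcons !p'E /f lractA; apply: gM.
- move=> a; apply: tcons_ext => [||u t].
  + by move=> k u v; rewrite lin_p' mulrDl scalerAl.
  + exact: lin_p'.
  + by have [_ _ _ _ [geps _ _]] := gP a; rewrite p'E /f geps.
- move=> a b; rewrite p'E /f p_x.
  have [phie _ lin_g _ [_ gphi _]] := gP a.
  case: eqP => [<-|_]; first by rewrite [ract _ _]phie gphi.
  by rewrite (lin0 ((ract_bilin M).1 _)) (lin0 lin_g).
- apply: tcons_ext => [||u t].
  + by [].
  + move=> k u v; rewrite scaler_sumr -big_split; apply: eq_bigr => a _.
    by rewrite lin_p' (lact_bilin _).2.
  + rewrite [in LHS](yE t) (lin_sum _ _ _ ((tcons_bilin M j).1 u)).
    apply: eq_bigr => a _; have [_ _ _ _ [_ _ phiK]] := gP a.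
    rewrite p'E /f lact_tcons -tcons_balanced; congr tcons.
    by apply/esym/phiK; rewrite [LHS]dual_ractA p_eps.
Qed.

End DualBasis.

Lemma regular_dual_basis (K : fieldType) (R : falgType K) q (e : 'I_q -> R)
    (m : 'I_q -> nat) :
  (forall i, e i * e i = e i) -> pim_multiplicities e m ->
  has_dual_basis (regular_bimodule R) (fun a : {i & 'I_(m i)} => e (tag a)).
Proof.
move=> ee [F [G FK GK]].
set D := dsum _ in F G FK GK.
pose p (a : {i & 'I_(m i)}) (y : R) : R :=
  val ((dcoord (tag a) (F y) : {ffun 'I_(m (tag a)) -> lideal (e (tag a))})
         (tagged a)).
pose d (a : {i & 'I_(m i)}) : D :=
  dsum_of (fun i =>
    [ffun k => if Tagged (fun i => 'I_(m i)) k == a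
               then in_lideal (ee i) (ee i) else 0]
    : {ffun 'I_(m i) -> lideal (e i)}).
have FD u v : F (u + v) = F u + F v by exact: (raddfD F).
have FM r u : F (r * u) = r *: F u by exact: (linearZ_LR F r u).
have pD a u v : p a (u + v) = p a u + p a v.
  by rewrite /p FD [dcoord _ _]dsum_ofE ffunE.
have pM a r u : p a (r * u) = r * p a u.
  by rewrite /p FM [dcoord _ _]dsum_ofE ffunE.
have p0 a : p a 0 = 0 by have := pD a 0 0; rewrite addr0 -[LHS]addr0 => /addrI.
have pe a y : p a y * e (tag a) = p a y by rewrite lideal_valP.
have px a b : p a (G (d b)) = if a == b then e (tag a) else 0.
  rewrite /p GK [dcoord _ _]dsum_ofE ffunE.
  have -> : Tagged (fun i => 'I_(m i)) (tagged a) = a by case: (a).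
  by case: eqP => // ->.
have p_inj y z : (forall a, p a y = p a z) -> y = z.
  move=> yz; apply: (can_inj FK); apply/dsumP => i; apply/ffunP => k.
  by apply: val_inj; exact: yz (Tagged (fun i => 'I_(m i)) k).
exists (fun a => G (d a) : R), p; split=> //.
  move=> a k u v; rewrite pD -[k *: u]mul1r -[in LHS]scalerAr scalerAl pM.
  by rewrite -scalerAl mul1r.
move=> y; apply: p_inj => b.
rewrite (big_morph _ (pD b) (p0 b)) (bigD1 b) //= pM px eqxx pe.
by rewrite big1 ?addr0 // => a /negPf ab; rewrite pM px eq_sym ab mulr0.
Qed.

Lemma dual_basis_embedding (K : fieldType) (R : falgType K) (T T' : finType)
    (X Y : bimodule R) (eps : T -> R) (eps' : T' -> R) (sigma : T -> T') :
  injective sigma -> (forall a, eps' (sigma a) = eps a) ->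
  has_dual_basis X eps -> has_dual_basis Y eps' ->
  exists Psi : X -> Y,
    [/\ linear Psi, forall r x, Psi (lact r x) = lact r (Psi x) &
        forall x, Psi x = 0 -> x = 0].
Proof.
move=> inj_s epsE [x [p [lin_p lact_p p_eps p_x xE]]].
move=> [y [p' [lin_p' lact_p' p'_eps p'_y yE]]].
exists (fun z => \sum_a lact (p a z) (y (sigma a))); split.
- move=> k u v; rewrite scaler_sumr -big_split; apply: eq_bigr => a _.
  by rewrite lin_p (lact_bilin Y).2.
- move=> r z; rewrite lin_sum; last exact: (lact_bilin Y).1.
  by apply: eq_bigr => a _; rewrite lact_p lactA.
move=> z Psiz0; rewrite (xE z) big1 // => b _.
suff -> : p b z = 0 by exact: (lin0 ((lact_bilin X).2 _)).
rewrite -(lin0 (lin_p' (sigma b))) -Psiz0 lin_sum // (bigD1 b) //=.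
rewrite big1 => [|a ab]; rewrite lact_p' p'_y.
  by rewrite eqxx addr0 epsE p_eps.
by rewrite (inj_eq inj_s) eq_sym (negPf ab) mulr0.
Qed.

(** * Comparison of multiplicities *)

Section Multiplicity.
Variables (K : fieldType) (R : falgType K) (T T' I : finType).
Variables (e : I -> R) (s : T -> I) (s' : T' -> I) (X Y : bimodule R).
Variables (j : I) (c : R).

(** When c is idempotent, these are the images of c under the left linear maps
    from R c / J c to R, J being the Jacobson radical. *)
Definition jac_killed x := c * x = x /\ forall a, in_jacobson a -> a * x = 0.

Hypothesis soc_j : exists w, [/\ w != 0, w * e j = w & jac_killed w].
Hypothesis soc_other :
  forall i x, x * e i = x -> jac_killed x -> x != 0 -> i = j.

(** Let D be the space of the d in R (e j) with c d = d and J d = 0. The elements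
    z of X with c z = z and J z = 0 are those whose coordinates have these
    properties, so they form a sum of copies of D, one for each summand of X of
    type j. Since Psi preserves these conditions, it embeds this power of D
    into the corresponding power for Y. *)
Lemma multiplicity_le (Psi : X -> Y) :
  has_dual_basis X (e \o s) -> has_dual_basis Y (e \o s') ->
  linear Psi -> (forall r x, Psi (lact r x) = lact r (Psi x)) ->
  (forall x, Psi x = 0 -> x = 0) ->
  (#|[pred a | s a == j]| <= #|[pred a | s' a == j]|)%N.
Proof.
move=> [x [p [lin_p lact_p p_eps p_x xE]]] [y [p' [lin_p' lact_p' p'_eps _ yE]]].
move=> lin_Psi lact_Psi inj_Psi.
pose W : {pred R} := fun x => `[< x * e j = x /\ jac_killed x >].
have W_closed : submod_closed W.
  split=> [|k u v]; rewrite !unfold_in /W.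
    by apply/asboolP; split; [|split=> [|a _]]; rewrite ?mul0r ?mulr0.
  move=> /asboolP[ue [cu Ju]] /asboolP[ve [cv Jv]]; apply/asboolP.
  split; first by rewrite mulrDl -scalerAl ue ve.
  split=> [|a aJ]; first by rewrite mulrDr -scalerAr cu cv.
  by rewrite mulrDr -scalerAr Ju ?Jv // scaler0 addr0.
pose WS : submodClosed R :=
  HB.pack W (GRing.isSubmodClosed.Build K R W W_closed).
have [D DE] := submod_vspace WS.
have DP u : reflect (u * e j = u /\ jac_killed u) (u \in D).
  by rewrite -DE; apply: asboolP.
have D_gt0 : (0 < \dim D)%N.
  have [w [w0 we cw]] := soc_j; rewrite lt0n dimv_eq0; apply: contraNneq w0 => D0.
  by rewrite -memv0 -D0; apply/DP.
pose A := {a : T | s a == j}; pose A' := {a : T' | s' a == j}.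
pose ins (v : {ffun A -> subvs_of D}) : X :=
  \sum_(a : A) lact (vsval (v a)) (x (val a)).
have lin_ins : linear ins.
  move=> k u v; rewrite /ins scaler_sumr -big_split; apply: eq_bigr => a _.
  by rewrite !ffunE linearP (lact_bilin X).2.
pose f (v : {ffun A -> subvs_of D}) : {ffun A' -> subvs_of D} :=
  [ffun b : A' => vsproj D (p' (val b) (Psi (ins v)))].
have lin_f : linear f.
  move=> k u v; apply/ffunP => b.
  by rewrite !ffunE lin_ins lin_Psi lin_p' linearP.
have p_ins v (a : A) : p (val a) (ins v) = vsval (v a).
  rewrite /ins lin_sum // (bigD1 a) //= big1 ?addr0 => [|b ba].
    rewrite lact_p p_x eqxx /= (eqP (valP a)).
    by have /DP[] := subvsP (v a).
  rewrite lact_p p_x eq_sym; case: eqP => [/val_inj ab|_]; last by rewrite mulr0.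
  by rewrite ab eqxx in ba.
have inj_f v : f v = 0 -> v = 0.
  move=> fv0; set z := Psi (ins v).
  have killed b : jac_killed (p' b z).
    have lact_ins r :
        (forall d, d \in D -> r * d = d) -> lact r (ins v) = ins v.
      move=> rD; rewrite /ins lin_sum; last exact: (lact_bilin X).1.
      by apply: eq_bigr => a _; rewrite lactA rD ?subvsP.
    split=> [|r rJ].
      by rewrite -lact_p' -lact_Psi lact_ins // => d /DP[_ []].
    rewrite -lact_p' -lact_Psi /ins lin_sum; last exact: (lact_bilin X).1.
    rewrite big1 ?(lin0 lin_Psi) ?(lin0 (lin_p' b)) // => a _.
    have /DP[_ [_ Jd]] := subvsP (v a).
    by rewrite lactA Jd // (lin0 ((lact_bilin X).2 _)).
  have z0 : z = 0.
    rewrite (yE z) big1 // => b _.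
    suff -> : p' b z = 0 by rewrite (lin0 ((lact_bilin Y).2 _)).
    apply/eqP; apply: contraT => pz0.
    have sbj : s' b == j by apply/eqP/(soc_other (p'_eps b z)).
    have pzD : p' b z \in D.
      by apply/DP; split=> //; rewrite -[in RHS]p'_eps /= (eqP sbj).
    have /ffunP/(_ (exist _ b sbj : A')) := fv0; rewrite !ffunE.
    move=> /(congr1 vsval); rewrite /= vsprojK // => pz00.
    by rewrite -/z pz00 eqxx in pz0.
  apply/ffunP => a; rewrite ffunE; apply: val_inj; rewrite /= -p_ins.
  by rewrite (inj_Psi _ z0) (lin0 (lin_p _)).
have := injective_dim_le lin_f inj_f.
rewrite {1}/dim /= {1}[in leqRHS]/dim /= !card_sig.
have -> : dim (subvs_of D) = \dim D by [].
by rewrite leq_pmul2r.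
Qed.

End Multiplicity.

(** * Tensor powers of the dual bimodule of a quasi-Frobenius algebra *)

Section Nakayama.
Variables (K : fieldType) (R : falgType K) (q : nat) (e : 'I_q -> R).
Variables (m : 'I_q -> nat) (pi : 'S_q).
Hypotheses (e_pim : pim_representatives e) (e_nak : nakayama_permutation e pi).

Lemma pim_idem i : e i * e i = e i. Proof. by case: e_pim. Qed.

Lemma pim_indec i : indecomposable_lmod (lideal (e i)).
Proof. by case: e_pim => _ /(_ i)[]. Qed.

Lemma pim_neq0 i : e i != 0.
Proof.
apply/eqP => ei0; have [nz _] := pim_indec i; apply: nz => u.
apply: val_inj; have := lideal_valP u (pim_idem i).
by rewrite [X in _ * X]ei0 mulr0 => <-.
Qed.

Lemma pim_socle i : exists w, [/\ w != 0, w * e (pi i) = w, e i * w = w,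
    forall a, in_jacobson a -> a * w = 0 &
    forall x, x * e (pi i) = x -> x != 0 -> exists r, w = r * x].
Proof.
apply: nakayama_socle (e_nak i); rewrite ?pim_idem ?pim_neq0 //; exact: pim_indec.
Qed.

(** A factorization of e_i through R e_j makes R e_i a nonzero direct summand of
    the indecomposable module R e_j. *)
Lemma pim_connected i j r s : e i = s * (e j * r * e i) -> i = j.
Proof.
have ee := pim_idem.
move=> eiE; pose a := e i * s * e j; pose b := e j * r * e i.
have ab : a * b = e i.
  rewrite /a /b; transitivity (e i * (s * (e j * e j * r * e i))).
    by rewrite !mulrA.
  by rewrite ee -eiE ee.
have ae : a * e j = a by rewrite /a -mulrA ee.
have be : b * e i = b by rewrite /b -mulrA ee.
have eb : e j * b = b by rewrite /b !mulrA ee.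
have baba : b * a * (b * a) = b * a by rewrite mulrA -(mulrA b) ab be.
have eba : e j * (b * a) = b * a by rewrite mulrA eb.
have bae : b * a * e j = b * a by rewrite -mulrA ae.
have [ba0|ba] := lideal_primitive (ee j) (pim_indec j) baba eba bae.
  case/eqP: (pim_neq0 i); rewrite -(ee i) -{1}ab -ab.
  by rewrite mulrA -(mulrA a) ba0 mulr0 mul0r.
by case: e_pim => _ _ inj _; apply: inj; apply: lideal_iso ab ba.
Qed.

(** Let i = pi k'. The vector x generates the socle vector w of R e_i, for which
    e_k' w = w, so that w = y x with y in e_k' R e_k. As J x = 0, y is not in J;
    hence y generates R e_k, which forces k = k'. *)
Lemma pim_socle_type i k x : x * e i = x -> jac_killed (e k) x -> x != 0 ->
  i = pi k.
Proof.
move=> xe [ekx Jx] x0.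
have := pim_socle ((pi^-1)%g i); rewrite permKV => -[w [w0 _ ew _ w_min]].
have [r wE] := w_min x xe x0; set k' := (pi^-1)%g i in ew *.
pose y := e k' * r * e k.
have yx : y * x = w by rewrite /y -mulrA ekx -mulrA -wE.
have ye : y * e k = y by rewrite /y -mulrA pim_idem.
have [[s es]|yJ] := lideal_gen_or_jacobson (pim_idem k) (pim_indec k) ye.
  by rewrite (pim_connected es) permKV.
by case/eqP: w0; rewrite -yx Jx.
Qed.

Lemma tpow_dual_basis k : quasi_frobenius R -> pim_multiplicities e m ->
  has_dual_basis (tpow (dual_bimodule R) k)
    (fun a : {i & 'I_(m i)} => e ((pi ^+ k)%g (tag a))).
Proof.
move=> qf e_mult; elim: k => [|k IHk].
  have := regular_dual_basis pim_idem e_mult.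
  by under [X in has_dual_basis _ X]funext => a do rewrite -(perm1 (tag a)).
apply: tcons_dual_basis IHk => a; rewrite expgSr permM; set i := (pi ^+ k)%g _.
have [w [w0 wf ew _ w_min]] := pim_socle i.
exact: (dual_lideal qf (pim_idem i) (pim_idem _) (pim_indec i) w0 wf ew w_min).
Qed.

End Nakayama.

Lemma card_tag_perm (q : nat) (m : 'I_q -> nat) (sigma : 'S_q) j :
  #|[pred a : {i & 'I_(m i)} | sigma (tag a) == j]| = m (sigma^-1%g j).
Proof.
rewrite -sum1_card (eq_bigl (fun a : {i & 'I_(m i)} =>
  (tag a == sigma^-1%g j) && true)); last first.
  by move=> a; rewrite inE andbT -(inj_eq (@perm_inj _ sigma) (tag a)) permKV.
rewrite -(sig_big_dep (fun i => i == sigma^-1%g j) (fun _ _ => true)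
  (fun _ _ => 1%N)).
by rewrite big_pred1_eq sum1_card card_ord.
Qed.

Theorem theoremF (K : fieldType) (R : falgType K) (n : nat)
    (q : nat) (e : 'I_q -> R) (m : 'I_q -> nat) (pi : 'S_q) :
  (2 <= n)%N ->
  quasi_frobenius R ->
  pim_representatives e ->
  pim_multiplicities e m ->
  nakayama_permutation e pi ->
  frobenius (Aalg R n) <-> forall i : 'I_q, m i = m ((pi ^+ (n - 2)%N)%g i).
Proof.
case: n => [|[|N]] // _ qf e_pim e_mult e_nak; rewrite subn2 /=.
have basis k := tpow_dual_basis e_pim e_nak k qf e_mult.
have crit := @ttrunc_frobenius K R (dual_bimodule R) N.+1.
rewrite crit {crit} => [|j z _]; last exact: tcons_dual_eq0 (basis j).
split=> [[Psi [lin_Psi lact_Psi inj_Psi]] | m_pi]; last first.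
  pose sigma (a : {i & 'I_(m i)}) : {i & 'I_(m i)} :=
    Tagged (fun i => 'I_(m i)) (cast_ord (m_pi (tag a)) (tagged a)).
  apply: (dual_basis_embedding (sigma := sigma)) (basis N.+1) (basis 1%N).
    move=> [i k] [j l].
    move=> /(congr1 (fun u : {i & 'I_(m i)} => (tag u, tagged u : nat))).
    move=> [/perm_inj ij]; case: j / ij l => l kl.
    by congr existT; apply: val_inj.
  by move=> a; rewrite expg1 expgSr permM.
(* Here n = N + 2; the summands R e_j with j = pi^(N+1)(i) are compared. *)
have le_m i : (m i <= m ((pi ^+ N)%g i))%N.
  have soc_j : exists w, [/\ w != 0, w * e (pi ((pi ^+ N)%g i)) = w &
      jac_killed (e ((pi ^+ N)%g i)) w].
    have [w [w0 we ew Jw _]] := pim_socle e_pim e_nak ((pi ^+ N)%g i).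
    by exists w.
  have soc_only j x : x * e j = x -> jac_killed (e ((pi ^+ N)%g i)) x ->
      x != 0 -> j = pi ((pi ^+ N)%g i).
    by move=> xe cx x0; apply: (pim_socle_type e_pim e_nak xe cx x0).
  have := multiplicity_le soc_j soc_only (basis N.+1) (basis 1%N)
    lin_Psi lact_Psi inj_Psi.
  by rewrite !card_tag_perm -permM -expgSr permK expg1 expgSr permM permK.
have sum_m : (\sum_i m ((pi ^+ N)%g i) = \sum_i m i)%N.
  by rewrite [RHS](reindex_inj (@perm_inj _ (pi ^+ N)%g)).
have [_ ] := leqif_sum (fun i (_ : true) => leqif_eq (le_m i)).
by rewrite sum_m eqxx => /esym/forallP/= m_pi i; apply/eqP/m_pi.
Qed.
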